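(* Let $k$ be an algebraically closed field with a finite subfield $\mathbb{F}_q$, let $n$ be a natural number and let $(\mu;\nu)$ be a bipartition of $n$. Let $\mathcal{O}_{\mu;\nu}$ be the corresponding $\mathrm{GL}(V)$-orbit in the enhanced nilpotent cone $V\times\mathcal{N}$ (where $\dim V=n$), and $\mathbb{O}_{\mu;\nu}$ the corresponding $\mathrm{Sp}(W)$-orbit in the exotic nilpotent cone $W\times\mathfrak{N}_0$ (where $\dim W=2n$). Then $$|\mathbb{O}_{\mu;\nu}(\mathbb{F}_q)|=|\mathcal{O}_{\mu;\nu}(\mathbb{F}_{q^2})|.$$
   Context: A partition is a non-increasing sequence $\lambda=(\lambda_1,\lambda_2,\dots)$ of natural numbers that is eventually $0$; $l(\lambda)$ is the number of nonzero terms. A bipartition of $n$ is a pair of partitions $(\mu;\nu)$ such that $\mu+\nu$ (termwise sum) is a partition of $n$. Enhanced cone: let $V$ be an $n$-dimensional $k$-vector space, $\mathcal{N}\subset\mathrm{End}(V)$ the set of nilpotent endomorphisms, and let $\mathrm{GL}(V)$ act on $V\times\mathcal{N}$ by $g(v,x)=(gv,gxg^{-1})$. A Jordan basis for $x\in\mathcal{N}$ of Jordan type $\lambda$ is a basis $\{v_{ij} : 1\le i\le l(\lambda),1\le j\le\lambda_i\}$ of $V$ with $xv_{ij}=v_{i,j-1}$ for $j>1$ and $xv_{i1}=0$. $\mathcal{O}_{\mu;\nu}$ is the $\mathrm{GL}(V)$-orbit consisting of those $(v,x)$ such that $x$ has Jordan type $\mu+\nu$ and admits a Jordan basis with $v=\sum_i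 v_{i\mu_i}$ (with $v_{i0}=0$). Exotic cone: write $W=V\oplus V^*$ with symplectic form $\langle(v,f),(v',f')\rangle=f'(v)-f(v')$, and $K=\mathrm{Sp}(W)$. Let $\mathfrak{N}_0=\{y\in\mathrm{End}(W) : y\text{ nilpotent and }\langle yu,u\rangle=0\text{ for all }u\in W\}$. $K$ acts on the exotic nilpotent cone $W\times\mathfrak{N}_0$ by $g(w,y)=(gw,gyg^{-1})$. Embed $V\times\mathcal{N}$ in $W\times\mathfrak{N}_0$ by $(v,x)\mapsto((v,0),(x,x^t))$, where $x^t$ is the transpose acting on $V^*$. The $K$-orbits in $W\times\mathfrak{N}_0$ are in bijection with bipartitions of $n$ (Kato), $\mathbb{O}_{\mu;\nu}$ being the unique $K$-orbit containing the image of $\mathcal{O}_{\mu;\nu}$. Rational points: take $V=k^n$ with its standard $\mathbb{F}_q$-structure and $W=V\oplus V^*$ with the induced one. For a finite subfield $F\subset k$, $\mathcal{O}_{\mu;\nu}(F)$ (resp. $\mathbb{O}_{\mu;\nu}(F)$) is the set of points of the orbit whose vector coordinates and matrix entries all lie in $F$. $\mathbb{F}_{q^2}$ is the quadratic extension of $\mathbb{F}_q$ inside $k$. *)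

(* Defs.v *)
From HB Require Import structures.
From mathcomp Require Import all_boot all_order all_algebra.
From mathcomp Require Import mathcomp_extra boolp classical_sets functions cardinality.

Set Implicit Arguments.
Unset Strict Implicit.
Unset Printing Implicit Defensive.

Import GRing.Theory.

Local Open Scope classical_set_scope.
Local Open Scope ring_scope.

(* A partition is stored as the list of its nonzero terms: its i-th term,
   counted from 0, is nth 0 la i, and its length l(la) is size la. *)
Definition is_partition (la : seq nat) : bool :=
  sorted geq la && (0%N \notin la).

Definition partition_add (mu nu : seq nat) : seq nat :=
  mkseq (fun i => nth 0 mu i + nth 0 nu i)%N (maxn (size mu) (size nu)).

Definition is_partition_of (n : nat) (la : seq nat) : bool :=
  is_partition la && (sumn la == n).

Definition is_bipartition_of (n : nat) (mu nu : seq nat) : bool :=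
  [&& is_partition mu, is_partition nu & is_partition_of n (partition_add mu nu)].

Definition nilpotent_mx (R : pzRingType) (n : nat) (x : 'M[R]_n) : Prop :=
  exists m : nat, x ^+ m = 0.

(* The points of X all of whose coordinates lie in F. *)
Definition rational_points (k : fieldType) (m : nat) (F : divringClosed k)
    (X : set ('cV[k]_m * 'M[k]_m)) : set ('cV[k]_m * 'M[k]_m) :=
  [set p | [/\ X p, p.1 \is a mxOver F & p.2 \is a mxOver F]].

Section EnhancedCone.
Variables (k : fieldType) (n : nat).

Definition enhanced_cone : set ('cV[k]_n * 'M[k]_n) :=
  [set p | nilpotent_mx p.2].

(* In the family e the row index i starts at 0, while j runs from 1 to the
   i-th term of la; values of e at other indices are irrelevant. *)
Definition jordan_basis (x : 'M[k]_n) (la : seq nat)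
    (e : nat -> nat -> 'cV[k]_n) : Prop :=
  basis_of fullv [seq e i j | i <- iota 0 (size la), j <- iota 1 (nth 0%N la i)]
  /\ forall i j, (i < size la)%N -> (1 <= j <= nth 0%N la i)%N ->
       x *m e i j = if j == 1%N then 0 else e i j.-1.

Definition enhanced_orbit (mu nu : seq nat) : set ('cV[k]_n * 'M[k]_n) :=
  [set p | enhanced_cone p /\ exists e : nat -> nat -> 'cV[k]_n,
     jordan_basis p.2 (partition_add mu nu) e /\
     p.1 = \sum_(i < size (partition_add mu nu) | nth 0%N mu i != 0%N)
             e i (nth 0%N mu i)].

End EnhancedCone.

Section ExoticCone.
Variables (k : fieldType) (n : nat).

(* W = V (+) V^*: a vector of 'cV_(n + n) is col_mx v f, where f : 'cV_n holds
   the coordinates of a linear form in the dual basis, so f(v) = f^T v and the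
   transpose of an endomorphism x acts on V^* by the matrix x^T. *)
Definition symp_form (w w' : 'cV[k]_(n + n)) : k :=
  ((dsubmx w')^T *m usubmx w - (dsubmx w)^T *m usubmx w') 0 0.

Definition symplectic (g : 'M[k]_(n + n)) : Prop :=
  g \in unitmx /\
  forall w w', symp_form (g *m w) (g *m w') = symp_form w w'.

Definition exotic_cone : set ('cV[k]_(n + n) * 'M[k]_(n + n)) :=
  [set p | nilpotent_mx p.2 /\ forall u, symp_form (p.2 *m u) u = 0].

Definition symp_act (g : 'M[k]_(n + n)) (p : 'cV[k]_(n + n) * 'M[k]_(n + n)) :=
  (g *m p.1, g *m p.2 *m invmx g).

Definition is_symp_orbit (X : set ('cV[k]_(n + n) * 'M[k]_(n + n))) : Prop :=
  exists2 p, exotic_cone p & X = [set symp_act g p | g in symplectic].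

Definition exotic_embed (p : 'cV[k]_n * 'M[k]_n) :
    'cV[k]_(n + n) * 'M[k]_(n + n) :=
  (col_mx p.1 0, block_mx p.2 0 0 p.2^T).

(* The default set0 is irrelevant: when (mu; nu) is a bipartition of n, exactly
   one Sp(W)-orbit contains the image of enhanced_orbit mu nu. *)
Definition exotic_orbit (mu nu : seq nat) :
    set ('cV[k]_(n + n) * 'M[k]_(n + n)) :=
  xget set0 [set X | is_symp_orbit X /\
                     exotic_embed @` enhanced_orbit mu nu `<=` X].

End ExoticCone.

Arguments enhanced_orbit : clear implicits.
Arguments exotic_orbit : clear implicits.

(* Main.v *)
Require Import Defs.
From HB Require Import structures.
From mathcomp Require Import all_boot all_order all_algebra perm mxabelem.
From mathcomp Require Import mathcomp_extra boolp classical_sets functions cardinality.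
From mathcomp Require Import finmap zify ring.
Set Implicit Arguments.
Unset Strict Implicit.
Unset Printing Implicit Defensive.
Import GRing.Theory.
Local Open Scope ring_scope.

(** Both orbits are described by the same field-independent invariants, and
    the points satisfying them are then counted over finite fields.

    Invariants.  A nilpotent [x] and a vector [v] are, up to conjugation,
    determined by the ranks of the powers of [x] and by the set of pairs
    [(b, i)] for which [x ^+ b *m v] lies in the image of [x ^+ i].  For a
    Jordan basis of type [mu + nu] with [v] the sum of the [v_(i, mu_i)], these
    are [profile] and [heights]; conversely every pair [(v, x)] has such a
    Jordan basis for some bipartition ([enhanced_normal_form]), and the two
    invariants recover the bipartition.  This is [enhanced_orbitP].  In the
    exotic cone every point [(w, y)] is conjugate under the symplectic group to
    some [((v, 0), (x, x^T))] ([exotic_normal_form]), because [W] splits into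
    two [y]-stable Lagrangian subspaces, one of them containing [w].  The ranks
    then double and the condition on [(b, i)] is unchanged: [exotic_orbitP].
    Both invariants are insensitive to field extension, so a rational point of
    an orbit is a point over the finite field with these invariants.

    Counting the endomorphisms.  Put [Q = q ^ 2].  The number of nilpotent [x]
    over the field with [Q] elements with given ranks [rho] equals the number
    of admissible [y] over the field with [q] elements with ranks [2 rho]
    ([exotic_count_eq]).  Both obey a recursion that shifts [rho] by one.
    Writing [x = A B] through its image, the ranks of the powers of [B A] are
    the shifted ones.  Writing the alternating form [<y u, v>] as [P^T J' P]
    with [J'] symplectic of smaller size, [P J P^T J'] is of the same kind as
    [y] and has the shifted ranks.  The fibres are counted by adding rows one
    at a time ([card_lift], [card_isometry]), and the two transition factors
    agree ([isometry_lift_number]); for instance the order of [Sp_(2 n)] over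
    the small field is, up to a power of [q], the order of [GL_n] over the big
    one.

    Counting the vectors.  For fixed [x] and [y], the module [W] over the small
    field has two Jordan blocks for every block of [V] over the big one, and
    the condition on [(b, i)] only depends on which coordinates in a Jordan
    basis vanish.  Identifying the big field with pairs of elements of the
    small one, zero going to zero, gives the same number of vectors
    ([vector_count_eq]). *)

(** * Generators of a nilpotent endomorphism *)
Section Generators.
Variables (K : fieldType) (n : nat) (x : 'M[K]_n).
Implicit Types (v z : 'cV[K]_n).

Lemma mulmx_expD p a b (v : 'M_(n, p)) : x ^+ (a + b) *m v = x ^+ a *m (x ^+ b *m v).
Proof. by rewrite exprD -mulmxE mulmxA. Qed.

Lemma mulmx_expS p a (v : 'M_(n, p)) : x ^+ a.+1 *m v = x *m (x ^+ a *m v).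
Proof. by rewrite -[a.+1]add1n mulmx_expD expr1. Qed.

Lemma mulmx_expSr p a (v : 'M_(n, p)) : x ^+ a.+1 *m v = x ^+ a *m (x *m v).
Proof. by rewrite -[a.+1]addn1 mulmx_expD expr1. Qed.

Lemma mulmx_exp_eq0 p a b (v : 'M_(n, p)) : (a <= b)%N -> x ^+ a *m v = 0 -> x ^+ b *m v = 0.
Proof. by move=> /subnK <- h; rewrite mulmx_expD h mulmx0. Qed.

(** The vectors [u i] generate [V] as a module over the polynomials in [x]; by
    Nakayama this can be tested modulo the image of the nilpotent [x].  In this
    form a generator may be replaced without inverting any polynomial. *)
Definition generating (I : finType) (u : I -> 'cV[K]_n) : Prop :=
  forall v, exists (c : I -> K) z, v = \sum_i c i *: u i + x *m z.

Lemma generating_trans (I : finType) (u u' : I -> 'cV[K]_n) :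
  generating u ->
  (forall i, exists (c : I -> K) z, u i = \sum_j c j *: u' j + x *m z) ->
  generating u'.
Proof.
move=> gu /choice [c /choice [z uE]] v; have [d [w ->]] := gu v.
exists (fun j => \sum_i d i * c i j), (\sum_i d i *: z i + w).
rewrite mulmxDr addrA; congr (_ + _); rewrite mulmx_sumr.
under eq_bigr do rewrite uE scalerDr scaler_sumr.
rewrite big_split exchange_big; congr (_ + _).
  by apply: eq_bigr => j _; rewrite scaler_suml; apply: eq_bigr => i _; rewrite scalerA.
by apply: eq_bigr => i _; rewrite scalemxAr.
Qed.

Lemma generating_replace (I : finType) (u : I -> 'cV[K]_n) i0 (c : I -> K) z u1 :
  generating u -> c i0 != 0 -> u1 = \sum_j c j *: u j + x *m z ->
  generating (fun j => if j == i0 then u1 else u j).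
Proof.
move=> gu c0 u1E; apply: generating_trans gu _ => i.
have [->{i}|ne] := eqVneq i i0; last first.
  exists (fun j => (j == i)%:R), 0; rewrite mulmx0 addr0 (bigD1 i) //= eqxx scale1r.
  rewrite (negPf ne) big1 ?addr0 // => j /negPf ->; exact: scale0r.
exists (fun j => if j == i0 then (c i0)^-1 else - (c i0)^-1 * c j), (- (c i0)^-1 *: z).
rewrite (bigD1 i0) //= eqxx u1E (bigD1 i0) //=.
rewrite [X in _ + X + _](eq_bigr (fun j => - (c i0)^-1 *: (c j *: u j))); last first.
  by move=> j ji; rewrite !(negPf ji) scalerA mulNr.
rewrite -scaler_sumr -scalemxAr -[RHS]addrA -scalerDr scaleNr -scalerBr.
have -> (A B C : 'cV[K]_n) : A + B + C - (B + C) = A by rewrite -[A + B + C]addrA addrK.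
by rewrite scalerA mulVf // scale1r.
Qed.

Lemma generating_expand (I : finType) (u : I -> 'cV[K]_n) N v : generating u ->
  exists (C : I -> nat -> K) z,
    v = \sum_i \sum_(s < N) C i s *: (x ^+ s *m u i) + x ^+ N *m z.
Proof.
move=> gu; elim: N => [|N [C [z vE]]].
  exists (fun _ _ => 0), v; rewrite big1 ?add0r ?mul1mx // => i _; exact: big_ord0.
have [c [w zE]] := gu z.
exists (fun i s => if s == N then c i else C i s), w.
under eq_bigr do rewrite big_ord_recr /= eqxx.
rewrite big_split /= -addrA mulmx_expSr vE; congr (_ + _).
  apply: eq_bigr => i _; apply: eq_bigr => s _.
  by rewrite (ltn_eqF (ltn_ord s)).
rewrite zE mulmxDr mulmx_sumr; congr (_ + _).
by apply: eq_bigr => i _; rewrite scalemxAr.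
Qed.

(** Combination of the [x ^+ s *m u i], [s < lam i]: the coordinates of a vector
    in the (potential) Jordan basis with cyclic generators [u i]. *)
Definition cyclic_sum (I : finType) (u : I -> 'cV[K]_n) (lam : I -> nat)
    (C : I -> nat -> K) : 'cV[K]_n :=
  \sum_i \sum_(s < lam i) C i s *: (x ^+ s *m u i).

Lemma cyclic_expand (I : finType) (u : I -> 'cV[K]_n) lam v :
  nilpotent_mx x -> generating u -> (forall i, x ^+ lam i *m u i = 0) ->
  exists C, v = cyclic_sum u lam C.
Proof.
move=> [N xN] gu ann; have [C [z ->]] := generating_expand N v gu.
rewrite xN mul0mx addr0.
exists (fun i s => if (s < N)%N then C i s else 0).
apply: eq_bigr => i _.
rewrite (big_ord_widen_cond (maxn N (lam i)) predT (fun s => C i s *: (x ^+ s *m u i))) ?leq_maxl //.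
rewrite (big_ord_widen_cond (maxn N (lam i)) predT
  (fun s => (if (s < N)%N then C i s else 0) *: (x ^+ s *m u i))) ?leq_maxr //=.
rewrite [LHS]big_mkcond [RHS]big_mkcond; apply: eq_bigr => s _.
case: ltnP => sN; case: ltnP => sl //; last by rewrite scale0r.
by rewrite (mulmx_exp_eq0 sl) // scaler0.
Qed.

(** Rows are the family [x ^+ s *m u i], indexed by the pairs [(i, s)]; rank
    arguments about the family become rank arguments about this matrix. *)
Definition cyclic_mx (I : finType) (u : I -> 'cV[K]_n) (lam : I -> nat) :
   'M[K]_(#|{: {i : I & 'I_(lam i)}}|, n) :=
  \matrix_p let t : {i : I & 'I_(lam i)} := enum_val p in
    (x ^+ tagged t *m u (tag t))^T.

Definition coef_row (I : finType) (lam : I -> nat) (C : I -> nat -> K) :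
   'rV[K]_#|{: {i : I & 'I_(lam i)}}| :=
  \row_p let t : {i : I & 'I_(lam i)} := enum_val p in C (tag t) (tagged t).

Lemma cyclic_mxE (I : finType) (u : I -> 'cV[K]_n) lam C :
  coef_row lam C *m cyclic_mx u lam = (cyclic_sum u lam C)^T.
Proof.
rewrite mulmx_sum_row /cyclic_sum (sig_big_dep predT (fun _ => predT)
   (fun i (s : 'I_(lam i)) => C i s *: (x ^+ s *m u i))) /=.
rewrite linear_sum.
rewrite (reindex (fun p : 'I_#|{: {i : I & 'I_(lam i)}}| => enum_val p)) /=;
  last by apply: onW_bij; apply: enum_val_bij.
by apply: eq_bigr => p _; rewrite mxE rowK linearZ.
Qed.

Lemma coef_row_surj (I : finType) (lam : I -> nat) (r : 'rV[K]_#|{: {i : I & 'I_(lam i)}}|) :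
  exists C, r = coef_row lam C.
Proof.
exists (fun i s => if insub s is Some s' then
  r 0 (enum_rank (@Tagged I i (fun i => 'I_(lam i)) s')) else 0).
apply/rowP => p; rewrite mxE /= valK; congr (r 0 _).
by rewrite -[LHS]enum_valK; congr enum_rank; case: (enum_val p).
Qed.

Lemma card_cyclic_index (I : finType) (lam : I -> nat) :
  #|{: {i : I & 'I_(lam i)}}| = (\sum_i lam i)%N.
Proof.
rewrite card_tagged sumnE big_map big_enum /=; apply: eq_bigr => i _; exact: card_ord.
Qed.

Lemma cyclic_mx_full (I : finType) (u : I -> 'cV[K]_n) lam :
  (forall v, exists C, v = cyclic_sum u lam C) -> row_full (cyclic_mx u lam).
Proof.
move=> sp; rewrite -sub1mx; apply/rV_subP => r _.
have [C rE] := sp r^T; apply/submxP; exists (coef_row lam C).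
by rewrite cyclic_mxE -rE trmxK.
Qed.

Lemma cyclic_relation (I : finType) (u : I -> 'cV[K]_n) lam :
  (n < \sum_i lam i)%N ->
  exists2 C : I -> nat -> K, cyclic_sum u lam C = 0 &
    exists i s, (s < lam i)%N /\ C i s != 0.
Proof.
move=> lt; have: kermx (cyclic_mx u lam) != 0.
  rewrite kermx_eq0 /row_free; apply/eqP => rk.
  by move: (rank_leq_col (cyclic_mx u lam)); rewrite rk card_cyclic_index leqNgt lt.
case/rowV0Pn => r /sub_kermxP rM r0; have [C rE] := coef_row_surj r.
exists C; first by apply: trmx_inj; rewrite -cyclic_mxE -rE rM trmx0.
case/rV0Pn: r0 => p; rewrite rE mxE => nz.
by exists (tag (enum_val p)), (tagged (enum_val p)).
Qed.

Lemma cyclic_independent (I : finType) (u : I -> 'cV[K]_n) lam C :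
  (forall v, exists C, v = cyclic_sum u lam C) -> (\sum_i lam i = n)%N ->
  cyclic_sum u lam C = 0 -> forall i s, (s < lam i)%N -> C i s = 0.
Proof.
move=> sp sz C0 i s lt.
have: row_free (cyclic_mx u lam).
  have := cyclic_mx_full sp.
  by rewrite /row_free /row_full => /eqP ->; rewrite card_cyclic_index sz.
move=> /row_free_inj inj; have := inj _ (coef_row lam C) 0.
rewrite cyclic_mxE C0 trmx0 mul0mx => /(_ erefl) /rowP.
move=> /(_ (enum_rank (@Tagged I i (fun i => 'I_(lam i)) (Ordinal lt)))).
by rewrite !mxE enum_rankK.
Qed.

Lemma cyclic_size (I : finType) (u : I -> 'cV[K]_n) lam :
  (forall v, exists C, v = cyclic_sum u lam C) -> (n <= \sum_i lam i)%N.
Proof.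
move=> /cyclic_mx_full; rewrite /row_full -card_cyclic_index => /eqP <-.
exact: rank_leq_row.
Qed.

End Generators.

(** * Jordan bases adapted to a vector *)
Lemma exists_minimal (T : Type) (P : T -> Prop) (f : T -> nat) :
  (exists t, P t) -> exists2 t, P t & forall t', P t' -> (f t <= f t')%N.
Proof.
move=> [t0 Pt0]; have ex : exists m, `[< exists2 t, P t & f t = m >].
  by exists (f t0); apply/asboolP; exists t0.
case: (ex_minnP ex) => m /asboolP [t Pt ft] mmin; exists t => // t' Pt'.
by rewrite ft; apply: mmin; apply/asboolP; exists t'.
Qed.

Lemma sum_replace_lt (I : finType) (a : I -> nat) j a' : (a' < a j)%N ->
  (\sum_l (if l == j then a' else a l) < \sum_l a l)%N.
Proof.
move=> lt; rewrite (bigD1 j) // [X in (_ < X)%N](bigD1 j) //= eqxx.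
have -> : (\sum_(i | i != j) (if i == j then a' else a i) = \sum_(i | i != j) a i)%N.
  by apply: eq_bigr => i /negPf ->.
by rewrite ltn_add2r.
Qed.

Section NormalForm.
Variables (K : fieldType) (n : nat) (x : 'M[K]_n).
Implicit Types (v z w : 'cV[K]_n).

Lemma mulmx_expC p a b (w : 'M_(n, p)) : x ^+ a *m (x ^+ b *m w) = x ^+ b *m (x ^+ a *m w).
Proof. by rewrite -!mulmx_expD addnC. Qed.

(** Replaces a coordinate series starting at [x ^+ a] by [x ^+ a] times a vector
    that is [C a *: w] modulo the image of [x].  The second conclusion says that
    [z] stays in the cyclic subspace of [w], tested by the maps [B] killing it. *)
Lemma cyclic_factor (C : nat -> K) (a l : nat) w :
  (forall s, (s < a)%N -> (s < l)%N -> C s = 0) ->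
  exists z, let w1 := (if (a < l)%N then C a else 0) *: w + x *m z in
    x ^+ a *m w1 = \sum_(s < l) C s *: (x ^+ s *m w) /\
    forall p (B : 'M_(p, n)), (forall s, B *m (x ^+ s *m w) = 0) -> B *m z = 0.
Proof.
move=> Clow; exists (\sum_(s < l | (a < s)%N) C s *: (x ^+ (s - a.+1) *m w)); split.
  rewrite mulmxDr -mulmx_expSr mulmx_sumr.
  rewrite [RHS](bigID (fun s : 'I_l => (a < s)%N)) /= [RHS]addrC; congr (_ + _); last first.
    by apply: eq_bigr => s lt; rewrite -scalemxAr -mulmx_expD subnKC.
  case: ltnP => al.
    rewrite (bigD1 (Ordinal al)) /= ?ltnn // big1 ?addr0 ?scalemxAr // => s.
    rewrite -leqNgt => /andP [sa ne]; rewrite Clow ?scale0r // ltn_neqAle sa andbT.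
    by apply: contra ne => /eqP e; apply/eqP/val_inj.
  rewrite scale0r mulmx0 big1 // => s; rewrite -leqNgt => sa.
  by rewrite Clow ?scale0r // (leq_trans (ltn_ord s)).
move=> p B Bw; rewrite mulmx_sumr big1 // => s _.
by rewrite -scalemxAr Bw scaler0.
Qed.

Definition jordan_generators (I : finType) (u : I -> 'cV[K]_n) (lam : I -> nat) :=
  generating x u /\ forall i, x ^+ lam i *m u i = 0.

Lemma cV_sum_delta v : v = \sum_i v i 0 *: delta_mx i 0.
Proof.
by rewrite {1}[v]matrix_sum_delta; apply: eq_bigr => i _; rewrite big_ord1.
Qed.

(** A generating family with annihilating exponents [lam] of minimal sum is a
    Jordan family.  Otherwise the sum exceeds [n] and there is a relation; it
    reads [x ^+ a *m u1 = 0], where [u1] may replace a generator whose exponent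
    is larger than [a]. *)
Lemma jordan_generators_exist : nilpotent_mx x ->
  exists u : 'I_n -> 'cV[K]_n, exists2 lam, jordan_generators u lam & (\sum_i lam i = n)%N.
Proof.
move=> nilx; have [N xN] := nilx.
have [|[u lam] /= [gu ann] mini] := @exists_minimal _
   (fun p : ('I_n -> 'cV[K]_n) * ('I_n -> nat) => jordan_generators p.1 p.2)
   (fun p => \sum_i p.2 i)%N.
  exists (fun i => delta_mx i 0, fun=> N); split => [v|i] /=; last by rewrite xN mul0mx.
  by exists (fun i => v i 0), 0; rewrite mulmx0 addr0; apply: cV_sum_delta.
exists u, lam; first by [].
have sp v := cyclic_expand v nilx gu ann.
apply/eqP; rewrite eqn_leq (cyclic_size sp) andbT leqNgt.
apply/negP => /(cyclic_relation x u) [C C0 [i1 [s1 [s1l C1]]]].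
have ex : exists s, [exists i, (s < lam i)%N && (C i s != 0)].
  by exists s1; apply/existsP; exists i1; apply/andP.
case: (ex_minnP ex) => a /existsP [i0 /andP [al Ca]] amin.
have Clow i s : (s < a)%N -> (s < lam i)%N -> C i s = 0.
  move=> sa sl; apply/eqP; apply: contraT => nz.
  have /amin : [exists i, (s < lam i)%N && (C i s != 0)].
    by apply/existsP; exists i; apply/andP.
  by rewrite leqNgt sa.
have /choice [z zP] i := cyclic_factor (u i) (Clow i).
pose c i := if (a < lam i)%N then C i a else 0.
pose u1 := \sum_i c i *: u i + x *m \sum_i z i.
have au1 : x ^+ a *m u1 = 0.
  rewrite -C0 /u1 mulmx_sumr -big_split mulmx_sumr; apply: eq_bigr => i _.
  by have [-> _] := zP i.
pose u' i := if i == i0 then u1 else u i.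
pose lam' i := if i == i0 then a else lam i.
have /(mini (u', lam')) /= : jordan_generators u' lam'.
  split => /=; first by apply: (generating_replace (c := c) (z := \sum_i z i) gu); rewrite /c ?al.
  by move=> i; rewrite /u' /lam'; case: eqP.
by rewrite leqNgt sum_replace_lt.
Qed.

Definition vector_sum (I : finType) (u : I -> 'cV[K]_n) (a : I -> nat) :=
  \sum_i x ^+ a i *m u i.

(** Every vector is a sum of [x ^+ a i *m u i] for suitable Jordan generators:
    the unit factors of its coordinates are absorbed in the generators. *)
Lemma vector_normalize (I : finType) (u : I -> 'cV[K]_n) lam v :
  nilpotent_mx x -> jordan_generators u lam ->
  exists u' a, [/\ jordan_generators u' lam, forall i, (a i <= lam i)%N
     & v = vector_sum u' a].
Proof.
move=> nilx [gu ann]; have [C vE] := cyclic_expand v nilx gu ann.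
have H i : exists w1 a, [/\ (a <= lam i)%N, x ^+ lam i *m w1 = 0,
    exists c z, c != 0 /\ w1 = c *: u i + x *m z &
    \sum_(s < lam i) C i s *: (x ^+ s *m u i) = x ^+ a *m w1].
  case: (pselect (exists s, (s < lam i)%N && (C i s != 0))) => [ex|nex].
    case: (ex_minnP ex) => a /andP [al Ca] amin.
    have [|z] := @cyclic_factor (C i) a (lam i) (u i).
      move=> s sa sl; apply/eqP; apply: contraT => nz.
      by have := amin s; rewrite sl nz leqNgt sa => /(_ isT).
    rewrite al /= => -[e ann']; exists (C i a *: u i + x *m z), a; split => //.
    - exact: ltnW.
    - rewrite mulmxDr -scalemxAr ann scaler0 add0r -mulmx_expSr mulmx_expS.
      by rewrite ann' ?mulmx0 // => r; rewrite mulmx_expC ann mulmx0.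
    - by exists (C i a), z.
  exists (u i), (lam i); split => //.
    by exists 1, 0; rewrite oner_neq0 scale1r mulmx0 addr0.
  rewrite ann big1 // => s _; have [->|nz] := eqVneq (C i s) 0; first exact: scale0r.
  by case: nex; exists s; rewrite ltn_ord.
have [u' /choice [a H']] := choice H; exists u', a; split.
- split=> [|i]; last by have [] := H' i.
  apply: generating_trans gu _ => i; have [_ _ [c [z [c0 wE]]] _] := H' i.
  exists (fun j => if j == i then c^-1 else 0), (- c^-1 *: z).
  rewrite (bigD1 i) //= eqxx big1 ?addr0; last by move=> j /negPf ->; exact: scale0r.
  by rewrite wE scalerDr scalerA mulVf // scale1r -scalemxAr scaleNr addrK.
- by move=> i; have [] := H' i.
- rewrite vE /cyclic_sum /vector_sum; apply: eq_bigr => i _; by have [] := H' i.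
Qed.

Lemma jordan_generators_replace (I : finType) (u : I -> 'cV[K]_n) lam i j (c : K) z u1 :
  jordan_generators u lam -> j != i -> u1 = u i + c *: u j + x *m z ->
  x ^+ lam i *m u1 = 0 ->
  jordan_generators (fun l => if l == i then u1 else u l) lam.
Proof.
move=> [gu ann] ji u1E ann1; split=> [|l]; last by case: eqP => // ->.
apply: (generating_replace (c := fun l => if l == i then 1 else if l == j then c else 0) (z := z) gu).
  by rewrite eqxx oner_neq0.
rewrite (bigD1 i) //= eqxx (bigD1 j) //= eqxx (negPf ji) big1 ?addr0 ?scale1r //.
by move=> l /andP [/negPf -> /negPf ->]; rewrite scale0r.
Qed.

Lemma vector_sum_replace (I : finType) (u : I -> 'cV[K]_n) a i j u1 a' :
  j != i ->
  x ^+ a i *m u i + x ^+ a j *m u j = x ^+ a i *m u1 + x ^+ a' *m u j ->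
  vector_sum u a =
  vector_sum (fun l => if l == i then u1 else u l) (fun l => if l == j then a' else a l).
Proof.
move=> ji e; rewrite /vector_sum (bigD1 i) // (bigD1 j) //= addrA e.
rewrite [RHS](bigD1 i) // [X in _ = _ + X](bigD1 j) //= addrA !eqxx (negPf ji).
rewrite eq_sym (negPf ji); congr (_ + _); apply: eq_bigr => l /andP [/negPf -> /negPf ->].
by [].
Qed.

(** Among the expressions of [v] given by [vector_normalize], one minimizing
    the sum of the [a i] has both [a] and [lam - a] monotone along [lam].  If
    [lam j <= lam i] and one of the two inequalities fails, changing a single
    generator lowers one exponent: [u i] becomes [u i - u j] plus a term that
    restores [v] in the first case, and [u j] becomes
    [u j - x ^+ (lam i - lam j) *m u i] plus such a term in the second. *)
Lemma enhanced_normal_form v : nilpotent_mx x ->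
  exists (u : 'I_n -> 'cV[K]_n) lam a,
  [/\ jordan_generators u lam, (\sum_i lam i = n)%N, forall i, (a i <= lam i)%N,
      v = vector_sum u a &
      forall i j, (lam j <= lam i)%N ->
        (a j <= a i)%N /\ (lam j - a j <= lam i - a i)%N].
Proof.
move=> nilx; have [u0 [lam ju0 szlam]] := jordan_generators_exist nilx.
have [u1 [a1 [ju1 al1 vE1]]] := vector_normalize v nilx ju0.
have [|[u a] /= [ju al vE] mini] := @exists_minimal _
   (fun p : ('I_n -> 'cV[K]_n) * ('I_n -> nat) =>
     [/\ jordan_generators p.1 lam, forall i, (p.2 i <= lam i)%N & v = vector_sum p.1 p.2])
   (fun p => \sum_i p.2 i)%N.
  by exists (u1, a1).
exists u, lam, a; split => // i j lji.
have [->//|ji] := eqVneq j i.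
have main (i' j' : 'I_n) w a' c z : j' != i' -> w = u i' + c *: u j' + x *m z ->
    x ^+ lam i' *m w = 0 -> (a' < a j')%N ->
    x ^+ a i' *m u i' + x ^+ a j' *m u j' = x ^+ a i' *m w + x ^+ a' *m u j' -> False.
  move=> ji' wE ann1 lt e.
  pose u' l := if l == i' then w else u l.
  pose a'' l := if l == j' then a' else a l.
  suff P : [/\ jordan_generators u' lam, forall l, (a'' l <= lam l)%N & v = vector_sum u' a''].
    by have := mini (u', a'') P; rewrite /= leqNgt sum_replace_lt.
  split; last 1 first.
  - by rewrite vE; apply: vector_sum_replace.
  - exact: (jordan_generators_replace ju ji' wE ann1).
  - move=> l; rewrite /a''; case: eqP => // ->; exact: leq_trans (ltnW lt) (al _).
have [gu ann] := ju; split; rewrite leqNgt; apply/negP => lt.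
- apply: (main i j (u i + x ^+ (a j - a i) *m u j - u j) (a i) (-1) (x ^+ (a j - a i).-1 *m u j)) => //.
  + by rewrite -mulmx_expS prednK ?subn_gt0 // scaleN1r addrAC.
  + rewrite mulmxBr mulmxDr ann add0r mulmx_expC.
    by rewrite (mulmx_exp_eq0 lji (ann j)) mulmx0 subrr.
  + by rewrite mulmxBr mulmxDr -mulmx_expD subnKC 1?ltnW // subrK.
- have al_i := al i; have al_j := al j; pose dl := (lam i - lam j)%N.
  have h1 : (a j + dl < a i)%N by rewrite /dl; lia.
  have ij : i != j by rewrite eq_sym.
  pose c := if dl == 0%N then -1 else 0 : K.
  pose z := x ^+ (a i - a j).-1 *m u i - (if dl == 0%N then 0 else x ^+ dl.-1 *m u i).
  apply: (main j i (u j + x ^+ (a i - a j) *m u i - x ^+ dl *m u i) (a j + dl)%N c z) => //.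
  + rewrite /c /z mulmxBr -mulmx_expS prednK; last by lia.
    have [->|d0] := eqVneq dl 0%N; first by rewrite mul1mx mulmx0 subr0 scaleN1r addrAC.
    by rewrite -mulmx_expS prednK ?lt0n // scale0r addr0 addrA.
  + rewrite mulmxBr mulmxDr ann add0r -!mulmx_expD.
    rewrite !(mulmx_exp_eq0 _ (ann i)) ?subrr //; rewrite /dl; lia.
  + rewrite mulmxBr mulmxDr -!mulmx_expD subnKC; last by lia.
    by rewrite subrK addrC.
Qed.

End NormalForm.

(** * Rank and height invariants *)

(** For varying [b] and [i], this relation determines the position of [v] among
    the Jordan blocks.  It only refers to the additive structure and to [x],
    hence it makes sense over any field and is stable under extension. *)
Definition reaches (K : fieldType) n (x : 'M[K]_n) (v : 'cV[K]_n) (b i : nat) : bool :=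
  ((x ^+ b *m v)^T <= (x ^+ i)^T)%MS.

Lemma reachesP (K : fieldType) n (x : 'M[K]_n) v b i :
  reflect (exists z : 'cV[K]_n, x ^+ b *m v = x ^+ i *m z) (reaches x v b i).
Proof.
apply: (iffP submxP) => [[D e]|[z ->]]; last by exists z^T; rewrite trmx_mul.
by exists D^T; apply: trmx_inj; rewrite e trmx_mul trmxK.
Qed.

Section Invariants.
Variables (K : fieldType) (n : nat) (x : 'M[K]_n).
Variables (I : finType) (u : I -> 'cV[K]_n) (lam : I -> nat).
Hypotheses (nilx : nilpotent_mx x) (ju : jordan_generators x u lam).
Hypothesis szlam : (\sum_i lam i = n)%N.
Local Notation csum := (cyclic_sum x u lam).

Let spanned v : exists C, v = csum C.
Proof. by case: ju => gu ann; apply: cyclic_expand. Qed.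

Lemma cyclic_sum_inj C D : csum C = csum D ->
  forall j s, (s < lam j)%N -> C j s = D j s.
Proof.
move=> e j s lt; apply/eqP; rewrite -subr_eq0; apply/eqP.
pose B j s := C j s - D j s; rewrite -/(B j s).
apply: (cyclic_independent spanned szlam) lt; apply/eqP.
rewrite -(subrr (csum D)) -{1}e /cyclic_sum -sumrB; apply/eqP.
apply: eq_bigr => k _; rewrite -sumrB; apply: eq_bigr => r _; exact: scalerBl.
Qed.

Lemma cyclic_sum_shift b C : x ^+ b *m csum C =
  csum (fun j r => if (b <= r)%N then C j (r - b)%N else 0).
Proof.
rewrite mulmx_sumr; apply: eq_bigr => j _; rewrite mulmx_sumr.
rewrite [RHS](big_ord_widen_cond (b + lam j) predT
  (fun r => (if (b <= r)%N then C j (r - b)%N else 0) *: (x ^+ r *m u j))) ?leq_addl //=.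
rewrite [RHS]big_mkcond big_split_ord /= [X in _ = X + _]big1 ?add0r; last first.
  by move=> r _; rewrite [(b <= r)%N]leqNgt ltn_ord scale0r if_same.
apply: eq_bigr => s _; rewrite leq_addr addKn -scalemxAr mulmx_expD.
case: ltnP => // le; rewrite -mulmx_expD (mulmx_exp_eq0 le) ?scaler0 //.
by case: ju.
Qed.

(** The condition depends on the coordinates of the vector only through their
    support; this is what allows counting over different fields. *)
Lemma reaches_cyclic_sum C b i : reaches x (csum C) b i <->
  forall j s, (s < lam j)%N -> C j s != 0 -> (i <= s + b)%N || (lam j <= s + b)%N.
Proof.
split=> [/reachesP [z] | H].
  have [D ->] := spanned z; rewrite !cyclic_sum_shift => /cyclic_sum_inj e j s sl nz.
  rewrite orbC; case: leqP => //= lt; rewrite leqNgt; apply: contra nz => gt.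
  by have := e _ _ lt; rewrite leq_addl addnK leqNgt gt /= => ->.
rewrite /reaches /cyclic_sum mulmx_sumr linear_sum; apply: summx_sub => j _.
rewrite mulmx_sumr linear_sum; apply: summx_sub => s _ /=.
have [->|nz] := eqVneq (C j s) 0; first by rewrite scale0r mulmx0 trmx0 sub0mx.
rewrite -scalemxAr -mulmx_expD linearZ scalemx_sub //=.
have /orP [le|le] := H j s (ltn_ord s) nz.
  by rewrite [(b + s)%N]addnC -(subnKC le) mulmx_expD trmx_mul submxMl.
by rewrite [(b + s)%N]addnC (mulmx_exp_eq0 le) ?trmx0 ?sub0mx //; case: ju.
Qed.

Lemma vector_sum_cyclic a : (forall i, (a i <= lam i)%N) ->
  vector_sum x u a = csum (fun j s => (s == a j)%:R).
Proof.
move=> al; apply: eq_bigr => j _; case: (ltnP (a j) (lam j)) => lt.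
  rewrite (bigD1 (Ordinal lt)) //= eqxx scale1r big1 ?addr0 // => s ne.
  have /negPf -> : (s != a j :> nat) by apply: contra ne => /eqP e; apply/eqP/val_inj.
  exact: scale0r.
rewrite (mulmx_exp_eq0 lt) ?big1 //; last by case: ju.
by move=> s _; rewrite ltn_eqF ?scale0r // (leq_trans (ltn_ord s)).
Qed.

Lemma reaches_vector_sum a b i : (forall i, (a i <= lam i)%N) ->
  reaches x (vector_sum x u a) b i <->
  forall j, (lam j - a j <= b)%N || (i <= a j + b)%N.
Proof.
move=> al; rewrite (vector_sum_cyclic al); split=> [|H].
  move=> /reaches_cyclic_sum H j; have [le|lt] := leqP (lam j) (a j).
    by move: le; rewrite -subn_eq0 => /eqP ->.
  by have := H j (a j) lt; rewrite eqxx oner_neq0 => /(_ isT); lia.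
apply/reaches_cyclic_sum => j s lt.
by have [->|] := eqVneq s (a j); rewrite ?eqxx // => _; have := H j; lia.
Qed.

Lemma mxrank_sum_le (J : finType) (P : pred J) m (A : J -> 'M[K]_m) :
  (\rank (\sum_(j | P j) A j)%MS <= \sum_(j | P j) \rank (A j))%N.
Proof.
elim/big_rec2: _ => [|j r B _ le]; first by rewrite mxrank0.
by apply: leq_trans (mxrank_adds_leqif _ _) _; rewrite leq_add2l.
Qed.

Let part (P : pred nat) : 'M[K]_n :=
  (\sum_j \sum_(s < lam j | P s) <<(x ^+ s *m u j)^T>>)%MS.

Let rank_part P : (\rank (part P) <= \sum_j \sum_(s < lam j | P s) 1)%N.
Proof.
apply: leq_trans (mxrank_sum_le _ _) _; apply: leq_sum => j _.
apply: leq_trans (mxrank_sum_le _ _) _; apply: leq_sum => s _.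
by rewrite mxrank_gen rank_leq_row.
Qed.

Let part_sub (P : pred nat) j s : (s < lam j)%N -> P s -> ((x ^+ s *m u j)^T <= part P)%MS.
Proof.
move=> lt Ps; apply: (submx_trans _ (sumsmx_sup j _ (submx_refl _))) => //.
by apply: (sumsmx_sup (Ordinal lt)) => //; rewrite genmxE.
Qed.

(** The image of [x ^+ i] is spanned by the [x ^+ s *m u j] with [i <= s], and
    together with the remaining members of the family it spans everything.
    These two upper bounds on dimensions add up to [n], so both are sharp. *)
Lemma rank_jordan i : \rank (x ^+ i) = (\sum_j (lam j - i))%N.
Proof.
have cnt l : (\sum_(s < l | (i <= s)%N) 1 = l - i)%N.
  elim: l => [|l IH]; first by rewrite big_ord0.
  by rewrite big_mkcond big_ord_recr -big_mkcond /= IH; case: leqP; lia.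
have cnt' l : (\sum_(s < l | (s < i)%N) 1 + (l - i) = l)%N.
  elim: l => [|l IH]; first by rewrite big_ord0.
  rewrite big_mkcond big_ord_recr -big_mkcond /=.
  move: IH; move: (\sum_(s < l | (s < i)%N) 1)%N => S; case: ltnP; lia.
have h1 : (\rank (x ^+ i) <= \sum_j (lam j - i))%N.
  rewrite -mxrank_tr; under [X in (_ <= X)%N]eq_bigr do rewrite -cnt.
  apply: leq_trans (rank_part (fun s => i <= s)%N); apply: mxrankS.
  apply/rV_subP => r /submxP [D ->].
  rewrite -[D]trmxK -trmx_mul; have [C ->] := spanned D^T.
  rewrite cyclic_sum_shift linear_sum; apply: summx_sub => j _.
  rewrite linear_sum; apply: summx_sub => s _ /=; rewrite linearZ /=.
  case: leqP => le; last by rewrite scale0r sub0mx.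
  by rewrite scalemx_sub // part_sub.
apply/eqP; rewrite eqn_leq h1 /=.
have : (n <= \rank (x ^+ i) + \sum_j \sum_(s < lam j | (s < i)%N) 1)%N.
  rewrite -{1}(mxrank1 K n) -[\rank (x ^+ i)]mxrank_tr.
  apply: leq_trans (leq_trans (mxrank_adds_leqif _ _) (leq_add (leqnn _) (rank_part (fun s => s < i)%N))).
  apply: mxrankS; apply/rV_subP => r _.
  have [C e] := spanned r^T; rewrite -[r]trmxK e linear_sum; apply: summx_sub => j _.
  rewrite linear_sum; apply: summx_sub => s _ /=; rewrite linearZ scalemx_sub //=.
  case: (ltnP s i) => le; first exact: submx_trans (part_sub _ _) (addsmxSr _ _).
  rewrite -(subnKC le) mulmx_expD trmx_mul; apply: submx_trans (submxMl _ _) (addsmxSl _ _).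
move/(leq_trans (eq_leq szlam)).
rewrite -[X in (X <= _)%N](eq_bigr _ (fun j _ => cnt' (lam j))) big_split /=.
by rewrite addnC leq_add2r.
Qed.

End Invariants.

(** * Recovering a bipartition from its invariants *)
Section Profiles.
Local Open Scope nat_scope.

Definition nonincreasing n (f : 'I_n -> nat) := forall i j : 'I_n, i <= j -> f j <= f i.

Lemma sort_indices n (f : 'I_n -> nat) :
  exists2 p : 'I_n -> 'I_n, bijective p & nonincreasing (f \o p).
Proof.
pose t := [tuple f i | i < n]; have : perm_eq (sort_tuple geq t) t by rewrite perm_sort.
case/tuple_permP => p e; exists p; first exact: injF_bij (@perm_inj _ p).
move=> i j ij /=; have srt : sorted geq (sort geq t) by apply: sort_sorted => a b; rewrite orbC leq_total.
have sz : size (sort geq t) = n by rewrite size_sort size_tuple.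
have nthE (l : 'I_n) : nth 0 (sort geq t) l = f (p l).
  have -> : sort geq t = [tuple tnth t (p i) | i < n] :> seq nat := e.
  by rewrite -tnth_nth !tnth_mktuple.
rewrite -!nthE; move: ij; rewrite leq_eqVlt => /orP [/eqP -> //|lt].
apply: (sorted_ltn_nth (leT := geq) _ 0 srt) => //; last 2 first.
- by rewrite inE sz.
- by rewrite inE sz.
by move=> a b c; rewrite /= => h1 h2; exact: leq_trans h2 h1.
Qed.

Lemma sum_ltn n k : \sum_(j < n) (j < k) = minn n k.
Proof. by elim: n => [|n IH]; rewrite ?big_ord0 ?min0n // big_ord_recr /= IH; lia. Qed.

Lemma nonincreasing_count n (f : 'I_n -> nat) (i : 'I_n) t : nonincreasing f ->
  (t < f i) = (i < \sum_(j < n) (t < f j)).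
Proof.
move=> fni; apply/idP/idP => [lt|].
  suff : \sum_(j < n) (j < i.+1) <= \sum_(j < n) (t < f j).
    by rewrite sum_ltn; have := ltn_ord i; lia.
  apply: leq_sum => j _; case: ltnP => // le.
  by rewrite (leq_trans lt) // fni.
apply: contraLR; rewrite -leqNgt => le; rewrite -leqNgt.
suff : \sum_(j < n) (t < f j) <= \sum_(j < n) (j < i).
  by rewrite sum_ltn => /leq_trans; apply; exact: geq_minr.
apply: leq_sum => j _; case: (ltnP t (f j)) => // lt.
by case: (ltnP j i) => // /fni; lia.
Qed.

(** Consecutive differences of the profile count the terms larger than [t],
    that is, they give the conjugate partition. *)
Lemma profile_inj n (f g : 'I_n -> nat) : nonincreasing f -> nonincreasing g ->
  (forall t, \sum_i (f i - t) = \sum_i (g i - t)) -> f =1 g.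
Proof.
move=> fni gni e i.
have cnt (h : 'I_n -> nat) t : \sum_j (h j - t) = \sum_j (h j - t.+1) + \sum_j (t < h j).
  by rewrite -big_split; apply: eq_bigr => j _ /=; case: ltnP; lia.
have fg t : (t < f i) = (t < g i).
  rewrite !nonincreasing_count //; congr (_ < _).
  by have := cnt f t; rewrite e (cnt g) e => /addnI ->.
by apply/eqP; rewrite eqn_leq leqNgt fg ltnn /= leqNgt -fg ltnn.
Qed.

(** The height relation determines [f] once [f + f'] is known.  If
    [f j < g j], the relation for [f, f'] holds at [b = f j] and
    [i = f j + f' j] by monotony, whereas for [g, g'] it fails at [j]. *)
Lemma heights_le n (f f' g g' : 'I_n -> nat) : nonincreasing f -> nonincreasing f' ->
  (forall j, f j + f' j = g j + g' j) ->
  (forall b i, (forall j, (f j <= b) || (i <= f' j + b)) ->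
     forall j, (g j <= b) || (i <= g' j + b)) ->
  forall j, g j <= f j.
Proof.
move=> fni f'ni e H j; rewrite leqNgt; apply/negP => lt.
have := H (f j) (f j + f' j) _ j; rewrite leqNgt lt /=.
have : f j + f' j <= g' j + f j = false by have := e j; lia.
move=> -> /(_ _)/notF; apply=> l; have [le|/ltnW le] := leqP j l.
  by rewrite fni.
by rewrite [f j + _]addnC leq_add2r f'ni // orbT.
Qed.

(** Rank of the [t]-th power of a nilpotent matrix of Jordan type [la]. *)
Definition profile (la : seq nat) t := \sum_(i < size la) (nth 0 la i - t).

(** The relation [reaches] for a vector that is the sum of the members of
    height [mu_j] in the Jordan blocks of sizes [mu_j + nu_j]. *)
Definition heights (mu nu : seq nat) b i :=
  forall j, (nth 0 mu j <= b) || (i <= nth 0 nu j + b).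

Lemma partition_nth_le la i j : is_partition la -> i <= j -> nth 0 la j <= nth 0 la i.
Proof.
case/andP => srt _; rewrite leq_eqVlt => /orP [/eqP -> //|lt].
case: (ltnP j (size la)) => [jl|/(nth_default 0) -> //].
apply: (sorted_ltn_nth (leT := geq) _ 0 srt) => //; last exact: ltn_trans jl.
by move=> a b c; rewrite /= => h1 h2; exact: leq_trans h2 h1.
Qed.

Lemma nth_partition_add mu nu i :
  nth 0 (partition_add mu nu) i = nth 0 mu i + nth 0 nu i.
Proof.
rewrite /partition_add; set m := maxn _ _; have [lt|ge] := ltnP i m.
  by rewrite nth_mkseq.
by rewrite !nth_default ?size_mkseq //; move: ge; rewrite geq_max => /andP [].
Qed.

Section Bipartition.
Variables (n : nat) (mu nu : seq nat).
Hypothesis bip : is_bipartition_of n mu nu.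
Local Notation la := (partition_add mu nu).

Lemma bipartition_l i j : i <= j -> nth 0 mu j <= nth 0 mu i.
Proof. by case/and3P: bip => h _ _; apply: partition_nth_le. Qed.

Lemma bipartition_r i j : i <= j -> nth 0 nu j <= nth 0 nu i.
Proof. by case/and3P: bip => _ h _; apply: partition_nth_le. Qed.

Lemma bipartition_sum_le i j : i <= j -> nth 0 la j <= nth 0 la i.
Proof.
by move=> ij; rewrite !nth_partition_add leq_add ?bipartition_l ?bipartition_r.
Qed.

Lemma bipartition_gt0 i : i < size la -> 0 < nth 0 la i.
Proof.
case/and3P: bip => _ _ /andP [/andP [_ n0] _] lt; rewrite lt0n.
by apply: contra n0 => /eqP <-; exact: mem_nth.
Qed.

Lemma bipartition_sum : \sum_(i < size la) nth 0 la i = n.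
Proof.
case/and3P: bip => _ _ /andP [_ /eqP <-].
by rewrite sumnE (big_nth 0) big_mkord.
Qed.

Lemma bipartition_size : size la <= n.
Proof.
rewrite -bipartition_sum -[X in (X <= _)%N]card_ord -sum1_card leq_sum // => i _.
exact: bipartition_gt0.
Qed.

Lemma profile_widen t : profile la t = \sum_(i < n) (nth 0 la i - t).
Proof.
rewrite /profile (big_ord_widen n (fun i => nth 0 la i - t) bipartition_size).
rewrite big_mkcond; apply: eq_bigr => i _; case: ltnP => // le.
by rewrite nth_default.
Qed.

Lemma profile0 t : n <= t -> profile la t = 0.
Proof.
move=> nt; apply: big1 => i _; apply/eqP; rewrite subn_eq0 (leq_trans _ nt) //.
by rewrite -bipartition_sum (bigD1 i) //= leq_addr.
Qed.

Lemma heights_widen b i : heights mu nu b i <->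
  forall j : 'I_n, (nth 0 mu j <= b) || (i <= nth 0 nu j + b).
Proof.
split=> H j; first exact: H.
have [lt|le] := ltnP j n; first exact: (H (Ordinal lt)).
have : nth 0 la j = 0 by rewrite nth_default // (leq_trans bipartition_size).
by rewrite nth_partition_add; lia.
Qed.

End Bipartition.
End Profiles.

(** * The enhanced orbits *)
Section EnhancedOrbit.
Variables (K : fieldType) (n : nat) (mu nu : seq nat).
Hypothesis bip : is_bipartition_of n mu nu.
Local Notation la := (partition_add mu nu).

Lemma span_closed_ind (V : vectType K) (X : seq V) (P : V -> Prop) :
  P 0 -> (forall c v w, P v -> P w -> P (c *: v + w)) ->
  (forall v, v \in X -> P v) -> forall v, v \in <<X>>%VS -> P v.
Proof.
move=> P0 PD PX v; rewrite -[X]/(val (in_tuple X)) => /coord_span ->.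
elim/big_rec: _ => // i w _ Pw; apply: PD => //; apply: PX; exact: mem_nth.
Qed.

Lemma jordan_basis_generators (x : 'M[K]_n) e : jordan_basis x la e ->
  jordan_generators x (fun i : 'I_(size la) => e i (nth 0%N la i)) (fun i => nth 0%N la i) /\
  forall i s, (i < size la)%N -> (s < nth 0%N la i)%N ->
     x ^+ s *m e i (nth 0%N la i) = e i (nth 0%N la i - s)%N.
Proof.
move=> [bas xe].
have pw i s : (i < size la)%N -> (s < nth 0%N la i)%N ->
     x ^+ s *m e i (nth 0%N la i) = e i (nth 0%N la i - s)%N.
  move=> il; elim: s => [|s IH] sl; first by rewrite mul1mx subn0.
  rewrite mulmx_expS IH ?(ltnW sl) // xe //; last by lia.
  by case: eqP => [|_]; [lia | congr (e _ _); lia].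
split=> //; split => [v|i]; last first.
  have g0 := bipartition_gt0 bip (ltn_ord i).
  rewrite -{1}(prednK g0) mulmx_expS pw ?prednK // xe //; last by lia.
  by case: eqP => //; lia.
have : v \in fullv by exact: memvf.
rewrite -(span_basis bas); move: v; apply: span_closed_ind.
- by exists (fun=> 0), 0; rewrite mulmx0 addr0 big1 // => i _; exact: scale0r.
- move=> c _ _ [c1 [z1 ->]] [c2 [z2 ->]].
  exists (fun i => c * c1 i + c2 i), (c *: z1 + z2).
  rewrite scalerDr mulmxDr scaler_sumr scalemxAr addrACA -big_split; congr (_ + _).
  by apply: eq_bigr => i _ /=; rewrite scalerDl scalerA.
- move=> v /allpairsPdep [i [j []]]; rewrite mem_iota add0n => /= il; rewrite mem_iota => jl ->.
  have [->|jne] := eqVneq j (nth 0%N la i).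
    exists (fun i' => (i' == Ordinal il)%:R), 0; rewrite mulmx0 addr0.
    rewrite (bigD1 (Ordinal il)) //= eqxx scale1r big1 ?addr0 // => i' /negPf ->.
    exact: scale0r.
  exists (fun=> 0), (e i j.+1); rewrite xe //; last by lia.
  rewrite big1 ?add0r => [|i' _]; last exact: scale0r.
  by case: eqP => //; lia.
Qed.

Lemma generators_jordan_basis (x : 'M[K]_n) (u : 'I_n -> 'cV[K]_n) (e : nat -> nat -> 'cV[K]_n) :
  nilpotent_mx x ->
  jordan_generators x u (fun i => nth 0%N la i) ->
  (forall (i : 'I_n) j, (j <= nth 0%N la i)%N -> e i j = x ^+ (nth 0%N la i - j) *m u i) ->
  jordan_basis x la e.
Proof.
move=> nilx [gu ann] eE; split; last first.
  move=> i j il /andP [j0 jl]; have iN := leq_trans il (bipartition_size bip).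
  have := eE (Ordinal iN) j jl => /= ->; rewrite -mulmx_expS.
  case: eqP => [->|jne].
    rewrite subn1 prednK ?(bipartition_gt0 bip il) //.
    exact: (ann (Ordinal iN)).
  rewrite (eE (Ordinal iN)) /=; last by lia.
  by congr (x ^+ _ *m _); lia.
rewrite basisEdim; apply/andP; split; last first.
  rewrite dimvf /dim /= muln1 size_allpairs_dep.
  rewrite (eq_map (g := nth 0%N la)); last by move=> i; rewrite size_iota.
  rewrite sumnE big_map -[X in iota 0 X]subn0 -/(index_iota 0 (size la)) big_mkord.
  by rewrite (bipartition_sum bip).
apply/subvP => v _; have [C ->] := cyclic_expand v nilx gu ann.
apply: memv_suml => i _; apply: memv_suml => s _; apply: memvZ; apply: memv_span.
have sl := ltn_ord s; have il : (i < size la)%N.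
  by rewrite ltnNge; apply/negP => /(nth_default 0%N) h; move: (leq_trans sl (eq_leq h)).
apply/allpairsPdep; exists (i : nat), (nth 0%N la i - s)%N; split.
- by rewrite mem_iota.
- by rewrite mem_iota; lia.
- by rewrite eE ?leq_subr // subKn // ltnW.
Qed.

Lemma sorted_normal_form (x : 'M[K]_n) v : nilpotent_mx x ->
  exists (u : 'I_n -> 'cV[K]_n) lam a,
  [/\ jordan_generators x u lam /\ (\sum_i lam i = n)%N, forall i, (a i <= lam i)%N,
      v = vector_sum x u a, nonincreasing lam &
      nonincreasing a /\ nonincreasing (fun i => lam i - a i)%N].
Proof.
move=> nilx; have [u [lam [a [[gu ann] sz al vE mon]]]] := enhanced_normal_form v nilx.
have [p pbij pni] := sort_indices lam; have [p' pK p'K] := pbij.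
exists (u \o p), (lam \o p), (a \o p); split=> //.
- split; last by apply: etrans sz; rewrite [RHS](reindex p) //; exact: onW_bij.
  split=> [w|i]; last exact: ann.
  have [c [z ->]] := gu w; exists (c \o p), z; congr (_ + _).
  by rewrite (reindex p) //; exact: onW_bij.
- by move=> i; exact: al.
- by rewrite vE /vector_sum (reindex p) //; exact: onW_bij.
- by split=> i j ij; have [h1 h2] := mon _ _ (pni _ _ ij).
Qed.

Lemma enhanced_orbit_generators (v : 'cV[K]_n) (x : 'M[K]_n) :
  enhanced_orbit K n mu nu (v, x) ->
  nilpotent_mx x /\ exists u : 'I_(size la) -> 'cV[K]_n,
    jordan_generators x u (fun i => nth 0%N la i) /\
    v = vector_sum x u (fun i => nth 0%N nu i).
Proof.
move=> [/= nilx [e [jb ->]]]; have [ju pw] := jordan_basis_generators jb.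
split=> //; exists (fun i : 'I_(size la) => e i (nth 0%N la i)); split=> //.
rewrite /vector_sum big_mkcond; apply: eq_bigr => j _.
have E := nth_partition_add mu nu j.
case: eqP => [m0|m0] /=; last first.
  have lt : (nth 0%N nu j < nth 0%N la j)%N by lia.
  have lE : (nth 0%N la j - nth 0%N nu j = nth 0%N mu j)%N by lia.
  by rewrite pw // lE.
have -> : nth 0%N nu j = nth 0%N la j by lia.
by have [_ ->] := ju.
Qed.

Lemma reaches_bipartition (x : 'M[K]_n) (u : 'I_(size la) -> 'cV[K]_n) b i :
  nilpotent_mx x -> jordan_generators x u (fun i => nth 0%N la i) ->
  reaches x (vector_sum x u (fun i => nth 0%N nu i)) b i <-> heights mu nu b i.
Proof.
move=> nilx ju; rewrite (reaches_vector_sum nilx ju (bipartition_sum bip)) => [|j]; last first.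
  by rewrite nth_partition_add leq_addl.
split=> H j; last by rewrite nth_partition_add addnK; exact: H.
have [lt|le] := ltnP j (size la).
  by have := H (Ordinal lt); rewrite nth_partition_add addnK.
have : nth 0%N la j = 0%N by rewrite nth_default.
by rewrite nth_partition_add; lia.
Qed.

Theorem enhanced_orbitP (v : 'cV[K]_n) (x : 'M[K]_n) :
  enhanced_orbit K n mu nu (v, x) <->
  [/\ nilpotent_mx x, forall i, \rank (x ^+ i) = profile la i &
      forall b i, reaches x v b i <-> heights mu nu b i].
Proof.
split=> [/enhanced_orbit_generators [nilx [u [ju ->]]] | [nilx rk hts]].
  have sz := bipartition_sum bip; split=> // [i|b i]; first exact: (rank_jordan nilx ju sz).
  exact: reaches_bipartition.
have [u [lam [a [[ju sz] al vE lni [ani mni]]]]] := sorted_normal_form v nilx.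
have lamE : lam =1 (fun i => nth 0%N la i).
  apply: profile_inj => // [i j|t]; first exact: (bipartition_sum_le bip).
  by rewrite -(rank_jordan nilx ju sz) rk (profile_widen bip).
have hE b i : (forall j, (lam j - a j <= b)%N || (i <= a j + b)%N) <->
    forall j : 'I_n, (nth 0%N mu j <= b)%N || (i <= nth 0%N nu j + b)%N.
  by rewrite -(reaches_vector_sum nilx ju sz) // -vE hts (heights_widen bip).
have sumE j : (lam j - a j + a j = nth 0%N mu j + nth 0%N nu j)%N.
  by rewrite subnK // lamE nth_partition_add.
have aE j : a j = nth 0%N nu j.
  pose m (j : 'I_n) := nth 0%N mu j; pose m' (j : 'I_n) := nth 0%N nu j.
  have h1 : (m j <= lam j - a j)%N.
    by apply: (@heights_le _ _ a m m' mni ani) => // b i /hE.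
  have h2 : (lam j - a j <= m j)%N.
    apply: (@heights_le _ m m' (fun j => lam j - a j)%N a).
    - by move=> i1 i2; exact: (bipartition_l bip).
    - by move=> i1 i2; exact: (bipartition_r bip).
    - by move=> i; rewrite sumE.
    - by move=> b i /hE.
  move: h1 h2; rewrite /m.
  by have := sumE j; lia.
split=> //; pose u' i := if insub i is Some i' then u i' else 0.
have u'E (i : 'I_n) : u' i = u i by rewrite /u' valK.
exists (fun i j => x ^+ (nth 0%N la i - j) *m u' i); split.
  apply: (generators_jordan_basis (u := u)) => //.
    by have [gu ann] := ju; split => // i; rewrite -lamE.
  by move=> i j _; rewrite u'E.
rewrite /= vE /vector_sum [RHS]big_mkcond /=.
rewrite (big_ord_widen n (fun i => if nth 0%N mu i != 0%N then
  x ^+ (nth 0%N la i - nth 0%N mu i) *m u' i else 0)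
  (bipartition_size bip)).
rewrite [RHS]big_mkcond; apply: eq_bigr => i _; rewrite u'E.
have z0 : nth 0%N mu i = 0%N -> x ^+ a i *m u i = 0.
  by move=> m0; have := sumE i; rewrite subnK // m0 add0n -aE => <-; case: ju.
case: ltnP => le; last first.
  by apply: z0; have := nth_partition_add mu nu i; rewrite nth_default; lia.
case: eqP => //= _; congr (x ^+ _ *m _).
by rewrite nth_partition_add addKn aE.
Qed.

End EnhancedOrbit.

(** * Stable Lagrangian splittings of the exotic cone *)
Section Alternating.
Variables (K : fieldType).

Definition alternating n (B : 'M[K]_n) := B^T = - B /\ forall i, B i i = 0.

Lemma trmx_scalar11 (a : 'M[K]_1) : a^T = a.
Proof. by apply/matrixP => i j; rewrite mxE !ord1. Qed.

(** Being of the form [T - T^T] is a definition of alternating matrices that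
    is valid in every characteristic and is visibly stable by congruence. *)
Lemma alternatingP n (B : 'M[K]_n) :
  alternating B <-> exists T, B = T - T^T.
Proof.
split=> [[skew diag]|[T ->]]; last first.
  split=> [|i]; last by rewrite !mxE subrr.
  by rewrite linearB /= trmxK opprB.
exists (\matrix_(i, j) if (i < j)%N then B i j else 0).
apply/matrixP => i j; rewrite !mxE; case: ltngtP => [||/val_inj ->].
- by rewrite subr0.
- by rewrite sub0r => _; have /matrixP/(_ j i) := skew; rewrite !mxE.
- by rewrite diag subrr.
Qed.

Lemma alternating_congr m n (B : 'M[K]_n) (P : 'M[K]_(m, n)) :
  alternating B -> alternating (P *m B *m P^T).
Proof.
move/alternatingP => [T ->]; apply/alternatingP; exists (P *m T *m P^T).
by rewrite mulmxBr mulmxBl !trmx_mul trmxK mulmxA.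
Qed.

Lemma alternating_quad n (B : 'M[K]_n) (u : 'cV_n) :
  alternating B -> u^T *m B *m u = 0.
Proof.
move/(alternating_congr u^T); rewrite trmxK => -[_ d].
by apply/matrixP => i j; rewrite !ord1 d mxE.
Qed.

Lemma quad_alternating n (B : 'M[K]_n) :
  (forall u : 'cV_n, u^T *m B *m u = 0) -> alternating B.
Proof.
move=> q; have E i j : B i j = ((delta_mx i 0 : 'cV_n)^T *m B *m (delta_mx j 0 : 'cV_n)) 0 0.
  by rewrite trmx_delta -rowE -colE !mxE.
split=> [|i]; last by rewrite E q mxE.
apply/matrixP => i j; rewrite [LHS]mxE [RHS]mxE; apply/eqP; rewrite -addr_eq0.
have := q (delta_mx i 0 + delta_mx j 0).
rewrite [(_ + _)^T]linearD !mulmxDl !mulmxDr !q add0r addr0 => /matrixP/(_ 0 0).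
by rewrite mxE [RHS]mxE -!E addrC => ->.
Qed.

Lemma alternating_form_skew n (M : 'M[K]_n) p q (A : 'M[K]_(n, p)) (B : 'M[K]_(n, q)) :
  alternating M -> A^T *m M *m B = - (B^T *m M *m A)^T.
Proof. by case=> skew _; rewrite !trmx_mul trmxK skew mulNmx mulmxN opprK mulmxA. Qed.

End Alternating.

Section HyperbolicFrames.
Variables (K : fieldType) (N : nat) (M : 'M[K]_N).
Hypotheses (altM : alternating M) (unitM : M \in unitmx).
Variables (y : 'M[K]_N) (w : 'cV[K]_N).
Hypotheses (nily : nilpotent_mx y) (alty : alternating (M *m y)).

Let skewM (p q : nat) (A : 'M[K]_(N, p)) (B : 'M[K]_(N, q)) :
  A^T *m M *m B = - (B^T *m M *m A)^T.
Proof. exact: alternating_form_skew. Qed.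

Let skew0 (p q : nat) (A : 'M[K]_(N, p)) (B : 'M[K]_(N, q)) :
  B^T *m M *m A = 0 -> A^T *m M *m B = 0.
Proof. by move=> h; rewrite skewM h trmx0 oppr0. Qed.

Let selfadj : M *m y = y^T *m M.
Proof.
have [] := alty; rewrite trmx_mul (proj1 altM) mulmxN => /oppr_inj <- _.
by [].
Qed.

Let selfadjX s (p q : nat) (A : 'M[K]_(N, p)) (B : 'M[K]_(N, q)) :
  (y ^+ s *m A)^T *m M *m B = A^T *m M *m (y ^+ s *m B).
Proof.
elim: s A B => [|s IH] A B; first by rewrite !mul1mx.
by rewrite mulmx_expSr IH trmx_mul mulmx_expS -[A^T *m y^T *m M]mulmxA -selfadj !mulmxA.
Qed.

(** By self-adjointness, the pairing of [y ^+ s *m u] and [y ^+ t *m u] is a value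
    of such a quadratic form: cyclic subspaces under [y] are isotropic. *)
Lemma alternating_pow k : alternating (M *m y ^+ k).
Proof.
elim/ltn_ind: k => -[|[|k]] IH; first by rewrite mulmx1.
  by rewrite expr1.
have -> : M *m y ^+ k.+2 = y^T *m (M *m y ^+ k) *m y^T^T.
  by rewrite trmxK exprS exprSr -!mulmxE !mulmxA selfadj.
by apply: alternating_congr; apply: IH.
Qed.

Let form0 s t (u : 'cV[K]_N) : (y ^+ s *m u)^T *m M *m (y ^+ t *m u) = 0.
Proof.
rewrite selfadjX -mulmx_expD -mulmxA [M *m _]mulmxA mulmxA.
exact: alternating_quad (alternating_pow _).
Qed.

(** Bases of two transversal isotropic [y]-stable subspaces in duality.  The
    normal form is reached by enlarging such a frame step by step. *)
Definition hyperbolic_frame m (E F : 'M[K]_(N, m)) :=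
  [/\ E^T *m M *m E = 0, F^T *m M *m F = 0, F^T *m M *m E = 1%:M,
      exists A, y *m E = E *m A & exists C, y *m F = F *m C].

Lemma hyperbolic_frame_row m d (E F : 'M[K]_(N, m)) (E1 F1 : 'M[K]_(N, d)) :
  hyperbolic_frame E F -> hyperbolic_frame E1 F1 ->
  E^T *m M *m E1 = 0 -> E^T *m M *m F1 = 0 ->
  F^T *m M *m E1 = 0 -> F^T *m M *m F1 = 0 ->
  hyperbolic_frame (row_mx E E1) (row_mx F F1).
Proof.
move=> [h1 h2 h3 [A hA] [C hC]] [g1 g2 g3 [A1 hA1] [C1 hC1]] e1 e2 e3 e4.
split; rewrite ?tr_row_mx ?mul_col_mx ?mul_mx_row -?/(block_mx _ _ _ _)
  ?h1 ?h2 ?h3 ?g1 ?g2 ?g3 ?e1 ?e2 ?e3 ?e4.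
- by rewrite (skew0 e1) block_mx0.
- by rewrite (skew0 e4) block_mx0.
- by rewrite (skew0 e2) -scalar_mx_block.
- by exists (block_mx A 0 0 A1); rewrite hA hA1 mul_row_block !mulmx0 addr0 add0r.
- by exists (block_mx C 0 0 C1); rewrite hC hC1 mul_row_block !mulmx0 addr0 add0r.
Qed.

Definition cols_mx d (f : 'I_d -> 'cV[K]_N) : 'M[K]_(N, d) := \matrix_(i < N, j < d) f j i 0.

Lemma col_cols_mx d f (j : 'I_d) : col j (cols_mx f) = f j.
Proof. by apply/colP => i; rewrite !mxE. Qed.

Lemma mul_cols_mx d f p (B : 'M[K]_(p, N)) i (j : 'I_d) :
  (B *m cols_mx f) i j = (B *m f j) i 0.
Proof. by rewrite !mxE; apply: eq_bigr => l _; rewrite mxE. Qed.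

Lemma mulmx_cV_eq0 p q (A : 'M[K]_(p, q)) : (forall c : 'cV_q, A *m c = 0) -> A = 0.
Proof.
by move=> h; apply/matrixP => i j; have /colP/(_ i) := h (delta_mx j 0); rewrite -colE !mxE.
Qed.

Lemma mul_cols_mx_sum d f (c : 'cV_d) : cols_mx f *m c = \sum_j c j 0 *: f j.
Proof.
apply/colP => i; rewrite mxE summxE; apply: eq_bigr => j _.
by rewrite !mxE mulrC.
Qed.

Lemma cols_mx_kill d (f : 'I_d -> 'cV[K]_N) p (B : 'M[K]_(p, N)) :
  (forall j, B *m f j = 0) -> B *m cols_mx f = 0.
Proof. by move=> h; apply/matrixP => i j; rewrite mul_cols_mx h !mxE. Qed.

Lemma cols_mx_stable d (f : 'I_d -> 'cV[K]_N) (B : 'M[K]_N) :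
  (forall j, exists c, B *m f j = cols_mx f *m c) ->
  exists A, B *m cols_mx f = cols_mx f *m A.
Proof.
move=> /choice [c cE]; exists (\matrix_(i, j) c j i 0); apply/matrixP => i j.
rewrite mul_cols_mx cE [LHS]mxE [RHS]mxE; apply: eq_bigr => l _; congr (_ * _).
by rewrite mxE.
Qed.

Lemma cols_mx_delta d (f : 'I_d -> 'cV[K]_N) j : cols_mx f *m delta_mx j 0 = f j.
Proof. by rewrite -colE col_cols_mx. Qed.

(** Two vectors of order [d.+1] whose top pairing does not vanish span a
    nondegenerate sum of two isotropic cyclic subspaces.  With the second basis
    in reversed order, the Gram matrix is triangular with a nonzero constant
    diagonal; correcting this basis by the inverse Gram matrix makes the two
    bases dual. *)
Lemma hyperbolic_block d (u u' : 'cV[K]_N) :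
  y ^+ d.+1 *m u = 0 -> y ^+ d.+1 *m u' = 0 -> u'^T *m M *m (y ^+ d *m u) != 0 ->
  exists E F : 'M[K]_(N, d.+1),
  [/\ hyperbolic_frame E F,
      forall s, exists c, y ^+ s *m u = E *m c,
      forall s, exists c, y ^+ s *m u' = F *m c,
      forall c, exists C : nat -> K, E *m c = \sum_(s < d.+1) C s *: (y ^+ s *m u) &
      forall c, exists C : nat -> K, F *m c = \sum_(s < d.+1) C s *: (y ^+ s *m u')].
Proof.
move=> ann ann' gam.
pose E := cols_mx (fun j : 'I_d.+1 => y ^+ j *m u).
pose F0 := cols_mx (fun j : 'I_d.+1 => y ^+ (d - j) *m u').
pose G := F0^T *m M *m E.
have GE i j : G i j = (u'^T *m M *m (y ^+ (d - i + j) *m u)) 0 0.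
  rewrite mul_cols_mx [in RHS]mulmx_expD -[in RHS]selfadjX -!mulmxA [LHS]mxE [RHS]mxE.
  by apply: eq_bigr => l _; congr (_ * _); rewrite !mxE.
have unitG : G \in unitmx.
  rewrite unitmxE det_trig; last first.
    apply/is_trig_mxP => i j ij; rewrite GE (mulmx_exp_eq0 _ ann) ?mulmx0 ?mxE //.
    by have := ltn_ord i; lia.
  rewrite unitfE; apply/prodf_neq0 => i _; rewrite GE subnK -1?ltnS //.
  apply: contraNneq gam => z; apply/eqP/matrixP => a b.
  by rewrite !ord1 z mxE.
have spE s : exists c, y ^+ s *m u = E *m c.
  have [sd|ds] := ltnP s d.+1.
    by exists (delta_mx (Ordinal sd) 0); rewrite cols_mx_delta.
  by exists 0; rewrite mulmx0 (mulmx_exp_eq0 ds).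
have spF0 s : exists c, y ^+ s *m u' = F0 *m c.
  have [sd|ds] := leqP s d.
    by exists (delta_mx (inord (d - s)) 0); rewrite cols_mx_delta inordK ?subKn // ltnS leq_subr.
  by exists 0; rewrite mulmx0 (mulmx_exp_eq0 ds).
pose F := F0 *m (invmx G)^T.
have FF0 : F0 = F *m G^T by rewrite -mulmxA -trmx_mul mulmxV // trmx1 mulmx1.
have isoF0 : F0^T *m M *m F0 = 0.
  apply: cols_mx_kill => j; apply: skew0; apply: cols_mx_kill => i; exact: form0.
exists E, F; split.
- split.
  + apply: cols_mx_kill => j; apply: skew0; apply: cols_mx_kill => i; exact: form0.
  + by rewrite trmx_mul -!mulmxA (mulmxA M) (mulmxA F0^T) (mulmxA F0^T) isoF0 mul0mx mulmx0.
  + by rewrite trmx_mul trmxK -!mulmxA (mulmxA F0^T) mulVmx.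
  + by apply: cols_mx_stable => j; rewrite -mulmx_expS.
  + have [C hC] : exists C, y *m F0 = F0 *m C by apply: cols_mx_stable => j; rewrite -mulmx_expS.
    exists (G^T *m C *m (invmx G)^T).
    by rewrite {1}/F [LHS]mulmxA hC FF0 !mulmxA.
- exact: spE.
- by move=> s; have [c ->] := spF0 s; exists (G^T *m c); rewrite FF0 mulmxA.
- move=> c; exists (fun s => c (inord s) 0); rewrite mul_cols_mx_sum.
  by apply: eq_bigr => j _; rewrite inord_val.
- move=> c; exists (fun s => ((invmx G)^T *m c) (inord (d - s)) 0).
  rewrite -mulmxA mul_cols_mx_sum (reindex_inj rev_ord_inj) /=.
  apply: eq_bigr => j _; rewrite subSS subKn -1?ltnS //; congr (_ *: _).
  by congr (_ _ 0); apply: val_inj; rewrite /= inordK ?subSS // ltnS leq_subr.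
Qed.

Lemma hyperbolic_frame_left_inverse m (E F : 'M[K]_(N, m)) : hyperbolic_frame E F ->
  (row_mx F (- E))^T *m M *m row_mx E F = 1%:M.
Proof.
case=> h1 h2 h3 _ _.
rewrite tr_row_mx linearN /= !mul_col_mx !mul_mx_row !mulNmx h1 h2 h3 (skewM E F) h3.
by rewrite trmx1 opprK oppr0 -/(block_mx _ _ _ _) -scalar_mx_block.
Qed.

Lemma hyperbolic_frame_size m (E F : 'M[K]_(N, m)) : hyperbolic_frame E F -> (m + m <= N)%N.
Proof.
move=> fr; rewrite -{1}(mxrank1 K (m + m)) -(hyperbolic_frame_left_inverse fr).
by apply: leq_trans (mxrankM_maxr _ _) (rank_leq_row _).
Qed.

Section Extension.
Variables (m : nat) (E F : 'M[K]_(N, m)).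
Hypothesis frEF : hyperbolic_frame E F.

Let perp p (Z : 'M[K]_(N, p)) := E^T *m M *m Z = 0 /\ F^T *m M *m Z = 0.

Let perp_stable p (Z : 'M[K]_(N, p)) s : perp Z -> perp (y ^+ s *m Z).
Proof.
case: frEF => _ _ _ [A hA] [C hC] pZ; elim: s => [|s [IH1 IH2]]; first by rewrite mul1mx.
have step (X : 'M_(N, m)) D p' (Y : 'M_(N, p')) :
    y *m X = X *m D -> X^T *m M *m Y = 0 -> X^T *m M *m (y *m Y) = 0.
  move=> h XY; rewrite mulmxA -[X^T *m M *m y]mulmxA selfadj mulmxA -trmx_mul h trmx_mul.
  by rewrite -2!mulmxA (mulmxA X^T) XY mulmx0.
by rewrite mulmx_expS; split; [apply: step hA IH1 | apply: step hC IH2].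
Qed.

Let perp_nonzero : (m + m < N)%N -> exists2 z : 'cV[K]_N, perp z & z != 0.
Proof.
move=> lt; pose L := col_mx (E^T *m M) (F^T *m M).
have : kermx L^T != 0.
  rewrite kermx_eq0 /row_free; apply/eqP => rk.
  by have := rank_leq_col L^T; rewrite rk leqNgt lt.
case/rowV0Pn => r /sub_kermxP rL r0; exists r^T; last by rewrite trmx_eq0.
have : L *m r^T = 0 by rewrite -[L]trmxK -trmx_mul rL trmx0.
rewrite mul_col_mx -[X in _ = X]vsubmxK => /eq_col_mx [h1 h2].
by split; rewrite ?h1 ?h2 linear0.
Qed.

Let perp_dual (e : 'cV[K]_N) : perp e -> e != 0 ->
  exists2 u' : 'cV[K]_N, perp u' & u'^T *m M *m e != 0.
Proof.
case: frEF => h1 h2 h3 _ _ [p1 p2] e0.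
have EF : E^T *m M *m F = - 1%:M by rewrite skewM h3 trmx1.
have : M *m e != 0.
  by apply: contra e0 => /eqP Me; rewrite -[e]mul1mx -(mulVmx unitM) -mulmxA Me mulmx0.
case/cV0Pn => i nz; pose t : 'cV[K]_N := delta_mx i 0.
exists (t - E *m (F^T *m M *m t) + F *m (E^T *m M *m t)).
  split; rewrite mulmxDr mulmxBr [X in _ - X]mulmxA [X in _ - _ + X]mulmxA.
    by rewrite h1 EF mul0mx subr0 mulNmx mul1mx subrr.
  by rewrite h2 h3 mul0mx mul1mx subrr addr0.
have k (X : 'M_(N, m)) (b : 'cV_m) : X^T *m M *m e = 0 -> (X *m b)^T *m M *m e = 0.
  by move=> h; rewrite trmx_mul -2!mulmxA (mulmxA X^T) h mulmx0.
rewrite linearD linearB /= !mulmxDl !mulNmx (k _ _ p1) (k _ _ p2) subr0 addr0.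
apply: contra nz => /eqP z; apply/eqP; rewrite -[LHS]/((M *m e) i 0).
have := congr1 (fun A : 'M_1 => A 0 0) z; rewrite trmx_delta -rowE -row_mul !mxE.
by [].
Qed.

(** In the orthogonal of a frame, take [u] of maximal order and [u'] dual to its
    top power.  The part of [w] orthogonal to the frame projects to
    [h = y ^+ a *m u2] in the block of [u] and [u'], where [u2] still has
    maximal order.  Rebuilding the block from [u2] (with [u] or [u'] as second
    generator) puts this projection in the first of its two isotropic
    subspaces. *)
Lemma frame_extend (c : 'cV[K]_m) : (m + m < N)%N -> perp (w - E *m c) ->
  exists d (E' F' : 'M[K]_(N, m + d.+1)) c',
    [/\ hyperbolic_frame E' F', E'^T *m M *m (w - E' *m c') = 0 &
        F'^T *m M *m (w - E' *m c') = 0].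
Proof.
move=> lt pw; have [z pz z0] := perp_nonzero lt.
have [N0 yN0] := nily.
have ex : exists d, `[< forall z : 'cV[K]_N, perp z -> y ^+ d *m z = 0 >].
  by exists N0; apply/asboolP => t _; rewrite yN0 mul0mx.
case: (ex_minnP ex) => -[|d] /asboolP annU dmin.
  by move: z0; rewrite -[z]mul1mx -[1%:M]/(y ^+ 0) annU // eqxx.
have [u pu yu] : exists2 u : 'cV[K]_N, perp u & y ^+ d *m u != 0.
  apply: contrapT => nex.
  suff /dmin : `[< forall z : 'cV[K]_N, perp z -> y ^+ d *m z = 0 >] by rewrite ltnn.
  apply/asboolP => t pt; apply/eqP; apply: contraT => nz; case: nex; by exists t.
have [u' pu' gam] := perp_dual (perp_stable d pu) yu.
have [E1 [F1 [fr1 sE1 sF1 cE1 cF1]]] := hyperbolic_block (annU _ pu) (annU _ pu') gam.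
set wU := w - E *m c in pw.
(* The projection of wU to the block, by duality of its two bases. *)
pose h := E1 *m (F1^T *m M *m wU) - F1 *m (E1^T *m M *m wU).
have [g1 g2 g3 _ _] := fr1.
have E1h : E1^T *m M *m (wU - h) = 0.
  rewrite mulmxBr [X in _ - X]mulmxBr [E1^T *m M *m (E1 *m _)]mulmxA g1 mul0mx sub0r.
  by rewrite [E1^T *m M *m (F1 *m _)]mulmxA (skewM E1 F1) g3 trmx1 mulNmx mul1mx opprK subrr.
have F1h : F1^T *m M *m (wU - h) = 0.
  rewrite mulmxBr [X in _ - X]mulmxBr [F1^T *m M *m (F1 *m _)]mulmxA g2 mul0mx subr0.
  by rewrite [F1^T *m M *m (E1 *m _)]mulmxA g3 mul1mx subrr.
pose ub (b : bool) := if b then u else u'.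
have pub b : perp (ub b) by case: b.
have annb b : y ^+ d.+1 *m ub b = 0 by apply: annU.
have hort b s : (wU - h)^T *m M *m (y ^+ s *m ub b) = 0.
  apply: skew0; case: b => /=.
    by have [c1 ->] := sE1 s; rewrite trmx_mul -2!mulmxA (mulmxA E1^T) E1h mulmx0.
  by have [c1 ->] := sF1 s; rewrite trmx_mul -2!mulmxA (mulmxA F1^T) F1h mulmx0.
have [C hC] : exists C : bool -> nat -> K,
    h = \sum_b \sum_(s < d.+1) C b s *: (y ^+ s *m ub b).
  have [C1 C1E] := cE1 (F1^T *m M *m wU); have [C2 C2E] := cF1 (- (E1^T *m M *m wU)).
  exists (fun b => if b then C1 else C2).
  by rewrite big_bool /= -C1E -C2E mulmxN.
pose killed (x : 'cV[K]_N) := forall p (B : 'M_(p, N)),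
  (forall b s, B *m (y ^+ s *m ub b) = 0) -> B *m x = 0.
have main : exists u2 u2' a, [/\ h = y ^+ a *m u2, u2'^T *m M *m (y ^+ d *m u2) != 0,
    killed u2 & killed u2'].
  (* [a] is the least exponent occurring in [h], and [u2] the cofactor; when
     [h = 0] any [u2] of maximal order will do. *)
  pose nzC s := [exists b : bool, C b s != 0].
  case: (pselect (exists s, (s < d.+1)%N && nzC s)) => [exs|nex]; last first.
    exists u, u', d.+1; rewrite annU //; split=> //.
    - rewrite hC big1 // => b _; rewrite big1 // => s _.
      have [->|nz] := eqVneq (C b s) 0; first exact: scale0r.
      by case: nex; exists s; rewrite ltn_ord; apply/existsP; exists b.
    - by move=> p B Bk; have := Bk true 0%N; rewrite mul1mx.
    - by move=> p B Bk; have := Bk false 0%N; rewrite mul1mx.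
  case: (ex_minnP exs) => a /andP [ad /existsP [b0 Cb0]] amin.
  have Clow b s : (s < a)%N -> (s < d.+1)%N -> C b s = 0.
    move=> sa sd; apply/eqP; apply: contraT => nz; have := amin s.
    by rewrite sd leqNgt sa /=; apply; apply/existsP; exists b.
  have {z pz z0} /choice [z zP] b := cyclic_factor y (ub b) (Clow b).
  have kz b : killed (z b) by move=> p B Bk; have [_] := zP b; apply => s; apply: Bk.
  pose u2 := \sum_b (C b a *: ub b + y *m z b).
  exists u2, (ub (~~ b0)), a; split.
  - rewrite hC mulmx_sumr; apply: eq_bigr => b _.
    by have [<- _] := zP b; rewrite ad.
  - have ydz b : y ^+ d *m (y *m z b) = 0.
      by rewrite -mulmx_expSr; apply: kz => b' s; rewrite mulmx_expC annb mulmx0.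
    have -> : y ^+ d *m u2 = C b0 a *: (y ^+ d *m ub b0) + C (~~ b0) a *: (y ^+ d *m ub (~~ b0)).
      rewrite mulmx_sumr big_bool /= !mulmxDr !ydz !addr0 -!scalemxAr.
      by case: (b0) => //=; rewrite addrC.
    rewrite mulmxDr -!scalemxAr.
    have := form0 0 d (ub (~~ b0)); rewrite mul1mx => ->; rewrite scaler0 addr0.
    rewrite scaler_eq0 negb_or Cb0 /=; case: (b0) => //=.
    by rewrite skewM oppr_eq0 selfadjX trmx_eq0.
  - move=> p B Bk; rewrite mulmx_sumr big1 // => b _; rewrite mulmxDr -scalemxAr.
    have := Bk b 0%N; rewrite mul1mx => ->; rewrite scaler0 add0r mulmxA; apply: kz => b' s.
    by rewrite -mulmxA -mulmx_expS Bk.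
  - by move=> p B Bk; have := Bk (~~ b0) 0%N; rewrite mul1mx.
have [u2 [u2' [a [hE gam2 k2 k2']]]] := main.
have kk p (B : 'M_(p, N)) x : (forall b s, B *m (y ^+ s *m ub b) = 0) -> killed x ->
   forall s, B *m (y ^+ s *m x) = 0.
  by move=> Bk xk s; rewrite mulmxA; apply: xk => b r; rewrite -mulmxA -mulmx_expD Bk.
have ann x : killed x -> y ^+ d.+1 *m x = 0.
  by move=> xk; apply: xk => b s; rewrite mulmx_expC annb mulmx0.
have [E2 [F2 [fr2 sE2 _ cE2 cF2]]] := hyperbolic_block (ann _ k2) (ann _ k2') gam2.
have kE p (B : 'M_(p, N)) : (forall b s, B *m (y ^+ s *m ub b) = 0) -> B *m E2 = 0.
  move=> Bk; apply: mulmx_cV_eq0 => c0; rewrite -mulmxA; have [D ->] := cE2 c0.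
  by rewrite mulmx_sumr big1 // => s _; rewrite -scalemxAr kk ?scaler0.
have kF p (B : 'M_(p, N)) : (forall b s, B *m (y ^+ s *m ub b) = 0) -> B *m F2 = 0.
  move=> Bk; apply: mulmx_cV_eq0 => c0; rewrite -mulmxA; have [D ->] := cF2 c0.
  by rewrite mulmx_sumr big1 // => s _; rewrite -scalemxAr kk ?scaler0.
have [c1 c1E] := sE2 a.
have pk b s : perp (y ^+ s *m ub b) by apply: perp_stable.
have [pE1 pE2] : perp E2 by split; apply: kE => b s; have [] := pk b s.
have [pF1 pF2] : perp F2 by split; apply: kF => b s; have [] := pk b s.
exists d, (row_mx E E2), (row_mx F F2), (col_mx c c1).
have -> : w - row_mx E E2 *m col_mx c c1 = wU - h.
  by rewrite mul_row_col opprD addrA hE c1E.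
have [pw1 pw2] : perp (wU - h).
  rewrite hE c1E /perp; split; rewrite mulmxBr [X in _ - X]mulmxA ?pE1 ?pE2 mul0mx subr0.
    by case: pw.
  by case: pw.
split.
- exact: hyperbolic_frame_row.
- rewrite tr_row_mx !mul_col_mx pw1 (skew0 (kE _ _ _)) ?col_mx0 // => b s; exact: hort.
- rewrite tr_row_mx !mul_col_mx pw2 (skew0 (kF _ _ _)) ?col_mx0 // => b s; exact: hort.
Qed.

End Extension.

Lemma hyperbolic_frame_exists : exists m (E F : 'M[K]_(N, m)) c,
  [/\ hyperbolic_frame E F, w = E *m c & (m + m = N)%N].
Proof.
(* A frame that is either a basis or of size at least k, by induction on k. *)
have ext k : exists m (E F : 'M[K]_(N, m)) c,
  [/\ hyperbolic_frame E F, E^T *m M *m (w - E *m c) = 0, F^T *m M *m (w - E *m c) = 0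
     & (m + m = N \/ k <= m)%N].
  elim: k => [|k [m [E [F [c [fr pE pF mk]]]]]].
    exists 0%N, 0, 0, 0; rewrite !linear0 !mul0mx; split=> //; last by right.
    split; rewrite ?linear0 ?mul0mx //; first by apply/matrixP => -[].
    - by exists 0; rewrite mulmx0.
    - by exists 0; rewrite mulmx0.
  have := hyperbolic_frame_size fr; rewrite leq_eqVlt => /orP [/eqP e|lt].
    by exists m, E, F, c; split=> //; left.
  have {mk} km : (k <= m)%N by case: mk => // e; rewrite e ltnn in lt.
  have [d [E' [F' [c' [fr' pE' pF']]]]] := frame_extend fr lt (conj pE pF).
  exists (m + d.+1)%N, E', F', c'; split=> //; right; rewrite addnS ltnS.
  exact: leq_trans km (leq_addr _ _).
have [m [E [F [c [fr pE pF mN]]]]] := ext N.+1.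
have mmN : (m + m = N)%N by case: mN => // lt; have := hyperbolic_frame_size fr; lia.
exists m, E, F, c; split=> //.
have : (row_mx E F)^T *m M *m (w - E *m c) = 0.
  by rewrite tr_row_mx !mul_col_mx pE pF col_mx0.
have := hyperbolic_frame_left_inverse fr.
move: (row_mx F _) (row_mx E F); rewrite mmN => X g Xg1 gw.
have gK : g *m (X^T *m M) = 1%:M by apply: mulmx1C.
have gT : g^T \in unitmx by rewrite unitmx_tr; have [] := mulmx1_unit gK.
have : M *m (w - E *m c) = 0 by rewrite -[LHS](mulKmx gT) [g^T *m _]mulmxA gw mulmx0.
move/(congr1 (mulmx (invmx M))); rewrite mulKmx // mulmx0 => /eqP.
by rewrite subr_eq0 => /eqP.
Qed.

End HyperbolicFrames.

(** * The exotic orbits *)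
Section Conjugation.
Variables (K : fieldType) (n : nat).

Lemma conj_exp (g y : 'M[K]_n) s : g \in unitmx ->
  (g *m y *m invmx g) ^+ s = g *m y ^+ s *m invmx g.
Proof.
move=> gu; elim: s => [|s IH]; first by rewrite mulmx1 mulmxV.
by rewrite exprS IH exprS -!mulmxE !mulmxA mulmxKV.
Qed.

Lemma nilpotent_conj (g y : 'M[K]_n) : g \in unitmx ->
  nilpotent_mx y -> nilpotent_mx (g *m y *m invmx g).
Proof. by move=> gu [s ys]; exists s; rewrite conj_exp // ys mulmx0 mul0mx. Qed.

Lemma rank_conj (g y : 'M[K]_n) s : g \in unitmx ->
  \rank ((g *m y *m invmx g) ^+ s) = \rank (y ^+ s).
Proof.
move=> gu; rewrite conj_exp // mxrankMfree ?row_free_unit ?unitmx_inv //.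
by rewrite -mxrank_tr trmx_mul mxrankMfree ?mxrank_tr // row_free_unit unitmx_tr.
Qed.

Lemma reaches_conj (g y : 'M[K]_n) w b i : g \in unitmx ->
  reaches (g *m y *m invmx g) (g *m w) b i = reaches y w b i.
Proof.
move=> gu; apply/reachesP/reachesP => -[z]; rewrite !conj_exp // => e.
  exists (invmx g *m z); apply: (can_inj (mulKmx gu)).
  by rewrite !mulmxA -[RHS]e mulmxA mulmxKV.
by exists (g *m z); rewrite -!mulmxA !mulKmx // e.
Qed.

(** The linear map carrying one Jordan basis to the other.  Its
    compatibility with all combinations of the basis gives both its
    invertibility and its commutation with the endomorphisms. *)
Lemma jordan_conj (I : finType) (lam : I -> nat) (x x' : 'M[K]_n) (u u' : I -> 'cV_n) :
  nilpotent_mx x -> nilpotent_mx x' ->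
  jordan_generators x u lam -> jordan_generators x' u' lam -> (\sum_i lam i = n)%N ->
  exists2 g, g \in unitmx & g *m x = x' *m g /\
    forall C, g *m cyclic_sum x u lam C = cyclic_sum x' u' lam C.
Proof.
move=> nx nx' ju ju' sz.
have ex (y y' : 'M[K]_n) v v' : nilpotent_mx y -> jordan_generators y v lam ->
    exists g, forall C, g *m cyclic_sum y v lam C = cyclic_sum y' v' lam C.
  move=> ny [gv av].
  have := cyclic_mx_full (fun z => cyclic_expand z ny gv av).
  rewrite /row_full => /eqP rk.
  have fr : row_free (cyclic_mx y v lam) by rewrite /row_free rk card_cyclic_index sz.
  exists (pinvmx (cyclic_mx y v lam) *m cyclic_mx y' v' lam)^T => C.
  apply: trmx_inj; rewrite trmx_mul trmxK -cyclic_mxE mulmxA.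
  by rewrite -[coef_row _ _ *m _ *m _]mulmxA mulmxVp // mulmx1 cyclic_mxE.
have [g gE] := ex x x' u u' nx ju; have [g' g'E] := ex x' x u' u nx' ju'.
have sp z : exists C, z = cyclic_sum x u lam C by case: ju => gu au; apply: cyclic_expand.
exists g.
  have : g' *m g = 1%:M.
    apply/eqP; rewrite -subr_eq0; apply/eqP; apply: mulmx_cV_eq0 => z.
    by have [C ->] := sp z; rewrite mulmxBl mul1mx -mulmxA gE g'E subrr.
  by move/mulmx1_unit => -[].
split=> //; apply/eqP; rewrite -subr_eq0; apply/eqP; apply: mulmx_cV_eq0 => z.
have [C ->] := sp z; rewrite mulmxBl -!mulmxA gE.
have := cyclic_sum_shift (x := x) ju 1 C; rewrite expr1 => ->.
have := cyclic_sum_shift (x := x') ju' 1 C; rewrite expr1 => ->.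
by rewrite gE subrr.
Qed.

Lemma jordan_generators_of_sizes (I : finType) (lam : I -> nat) : (\sum_i lam i = n)%N ->
  exists (x : 'M[K]_n) (u : I -> 'cV_n), nilpotent_mx x /\ jordan_generators x u lam.
Proof.
pose T := {i : I & 'I_(lam i)}.
move=> sz; have e : #|{: T}| = n by rewrite card_cyclic_index.
case: _ / e in sz *.
pose dl (t : T) : 'cV[K]_#|{: T}| := delta_mx (enum_rank t) 0.
pose E i s := \sum_(t : T | (tag t == i) && (val (tagged t) == s)) dl t.
pose x : 'M[K]_#|{: T}| := cols_mx (fun p => E (tag (enum_val p : T)) (val (tagged (enum_val p : T))).+1).
have xdl t : x *m dl t = E (tag t) (val (tagged t)).+1.
  by rewrite cols_mx_delta enum_rankK.
have dlE (t : T) : dl t = E (tag t) (val (tagged t)).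
  rewrite /E (big_pred1 t) // => -[i' s'] /=.
  apply/andP/eqP => [[/eqP e1 /eqP e2]|<- //].
  by case: t e1 e2 => i s /= e1; subst i' => /val_inj ->.
have E0 i s : (lam i <= s)%N -> E i s = 0.
  move=> le; rewrite /E big_pred0 // => -[i' s'] /=; apply/negP => /andP [/eqP e1 /eqP e2].
  by move: le; rewrite -e2 -e1 leqNgt ltn_ord.
have xE i s : x *m E i s = E i s.+1.
  have [le|lt] := leqP (lam i) s; first by rewrite !E0 ?mulmx0 // ltnW.
  pose t : T := @Tagged I i (fun i => 'I_(lam i)) (Ordinal lt).
  by rewrite -[E i s]/(E (tag t) (val (tagged t))) -dlE xdl.
have xsE i r s : x ^+ r *m E i s = E i (s + r)%N.
  elim: r => [|r IH]; first by rewrite mul1mx addn0.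
  by rewrite mulmx_expS IH xE addnS.
have lamn i : (lam i <= #|{: T}|)%N by rewrite -sz (bigD1 i) //= leq_addr.
exists x, (fun i => E i 0%N); split.
  exists #|{: T}|; apply: mulmx_cV_eq0 => v; rewrite (cV_sum_delta v) mulmx_sumr big1 // => p _.
  rewrite -scalemxAr -[p]enum_valK -/(dl (enum_val p)) dlE xsE E0 ?scaler0 //.
  exact: leq_trans (lamn _) (leq_addl _ _).
split=> [v|i]; last by rewrite xsE E0.
exists (fun i => \sum_(p | (tag (enum_val p : T) == i) && (val (tagged (enum_val p : T)) == 0%N)) v p 0).
exists (\sum_(p | val (tagged (enum_val p : T)) != 0%N)
   v p 0 *: E (tag (enum_val p : T)) (val (tagged (enum_val p : T))).-1).
rewrite {1}(cV_sum_delta v) (bigID (fun p => val (tagged (enum_val p : T)) == 0%N)) /=; congr (_ + _).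
  under [RHS]eq_bigr do rewrite scaler_suml.
  rewrite (exchange_big_dep (fun p => val (tagged (enum_val p : T)) == 0%N)) /=;
    last by move=> i p _ /andP [].
  apply: eq_bigr => p p0; rewrite (big_pred1 (tag (enum_val p : T))) => [|i]; last first.
    by rewrite p0 andbT eq_sym.
  rewrite -{2}[p]enum_valK -/(dl (enum_val p)) dlE; congr (_ *: E _ _).
  exact: (eqP p0).
rewrite mulmx_sumr; apply: eq_bigr => p p0; rewrite -scalemxAr xE prednK ?lt0n //.
by rewrite -{2}[p]enum_valK -/(dl (enum_val p)) dlE.
Qed.

End Conjugation.

Section ExoticOrbit.
Variables (K : fieldType) (n : nat).

Definition symp_mx : 'M[K]_(n + n) := block_mx 0 (- 1%:M) 1%:M 0.

Lemma alternating_symp_mx : alternating symp_mx.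
Proof.
apply/alternatingP; exists (block_mx 0 0 1%:M 0).
by rewrite tr_block_mx !trmx0 trmx1 opp_block_mx add_block_mx !oppr0 !addr0 add0r.
Qed.

Lemma symp_mx_unit : symp_mx \in unitmx.
Proof.
have : symp_mx *m (- symp_mx) = 1%:M.
  rewrite opp_block_mx mulmx_block !oppr0 opprK !mul0mx !mulmx0 !add0r !addr0.
  by rewrite mulNmx mulmxN opprK !mulmx1 -scalar_mx_block.
by case/mulmx1_unit.
Qed.

Lemma symp_formE (w w' : 'cV[K]_(n + n)) : symp_form w w' = (w'^T *m symp_mx *m w) 0 0.
Proof.
rewrite /symp_form -{3}[w']vsubmxK -{3}[w]vsubmxK tr_col_mx mul_row_block mul_row_col.
rewrite !mulmx0 add0r addr0 mulmx1 mulmxN mulmx1 mulNmx; congr (_ _ 0 0); congr (_ - _).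
by rewrite -[LHS]trmx_scalar11 trmx_mul trmxK.
Qed.

Lemma scalar11_eq0 (a : 'M[K]_1) : (a 0 0 = 0) <-> a = 0.
Proof. by split=> [h|->]; [apply/matrixP => i j; rewrite !ord1 h | ]; rewrite mxE. Qed.

Lemma exotic_coneP w (y : 'M[K]_(n + n)) :
  exotic_cone (w, y) <-> nilpotent_mx y /\ alternating (symp_mx *m y).
Proof.
split=> -[/= ny h]; split=> //.
  apply: quad_alternating => u; apply/scalar11_eq0.
  by rewrite -[RHS](h u) symp_formE !mulmxA.
move=> u; rewrite symp_formE !mulmxA; apply/scalar11_eq0.
by have := alternating_quad u h; rewrite !mulmxA.
Qed.

Lemma symplecticP (g : 'M[K]_(n + n)) : g^T *m symp_mx *m g = symp_mx -> symplectic g.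
Proof.
move=> h; split=> [|w w'].
  have : invmx symp_mx *m g^T *m symp_mx *m g = 1%:M.
    by rewrite -!mulmxA [g^T *m _]mulmxA h mulVmx // symp_mx_unit.
  by case/mulmx1_unit.
rewrite !symp_formE trmx_mul -{2}h; congr (_ _ 0 0).
by rewrite !mulmxA.
Qed.

Lemma symplecticM (g h : 'M[K]_(n + n)) : symplectic g -> symplectic h -> symplectic (g *m h).
Proof.
move=> [gu gf] [hu hf]; split; first by rewrite unitmx_mul gu.
by move=> w w'; rewrite -!mulmxA gf hf.
Qed.

Lemma symp_actM (g h : 'M[K]_(n + n)) p : g \in unitmx -> h \in unitmx ->
  symp_act (g *m h) p = symp_act g (symp_act h p).
Proof.
move=> gu hu; rewrite /symp_act /= mulmxA; congr (_, _).
rewrite !mulmxA -[RHS]mulmxA; congr (_ *m _).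
have : (invmx h *m invmx g) *m (g *m h) = 1%:M by rewrite -mulmxA mulKmx // mulVmx.
move/(congr1 (mulmx^~ (invmx (g *m h)))); rewrite mulmxK ?unitmx_mul ?gu //.
by rewrite mul1mx => ->.
Qed.

Lemma exotic_cone_act g (p : 'cV[K]_(n + n) * 'M[K]_(n + n)) :
  symplectic g -> exotic_cone p -> exotic_cone (symp_act g p).
Proof.
move=> [gu gf] [np fp]; split=> /=; first exact: nilpotent_conj.
move=> u; rewrite -!mulmxA -{2}[u](mulKVmx gu) gf.
by rewrite fp.
Qed.

Lemma block_diag_exp (A B : 'M[K]_n) s :
  (block_mx A 0 0 B) ^+ s = block_mx (A ^+ s) 0 0 (B ^+ s).
Proof.
elim: s => [|s IH]; first by rewrite -scalar_mx_block.
by rewrite !exprS IH -mulmxE mulmx_block !mulmx0 !mul0mx !addr0 !add0r.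
Qed.

Lemma trmx_exp (A : 'M[K]_n) s : A^T ^+ s = (A ^+ s)^T.
Proof. by elim: s => [|s IH]; rewrite ?trmx1 // exprS exprSr IH -!mulmxE trmx_mul. Qed.

Lemma nilpotent_embed (v : 'cV[K]_n) (x : 'M_n) :
  nilpotent_mx (exotic_embed (v, x)).2 <-> nilpotent_mx x.
Proof.
rewrite /exotic_embed /=; split=> -[s]; last first.
  by move=> xs; exists s; rewrite block_diag_exp trmx_exp xs trmx0 block_mx0.
rewrite block_diag_exp -[X in _ = X]block_mx0 => /eq_block_mx [h _ _ _]; by exists s.
Qed.

Lemma exotic_cone_embed (v : 'cV[K]_n) (x : 'M_n) :
  nilpotent_mx x -> exotic_cone (exotic_embed (v, x)).
Proof.
move=> nx; apply/exotic_coneP; split; first exact/nilpotent_embed.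
rewrite mulmx_block !mul0mx !mulmx0 !add0r mulNmx !mul1mx !addr0.
apply/alternatingP; exists (block_mx 0 0 x 0).
by rewrite tr_block_mx !trmx0 opp_block_mx add_block_mx !oppr0 !addr0 add0r.
Qed.

Lemma rank_embed (v : 'cV[K]_n) (x : 'M_n) s :
  \rank ((exotic_embed (v, x)).2 ^+ s) = (\rank (x ^+ s)).*2.
Proof. by rewrite block_diag_exp rank_diag_block_mx trmx_exp mxrank_tr addnn. Qed.

Lemma reaches_embed (v : 'cV[K]_n) (x : 'M_n) b i :
  reaches (exotic_embed (v, x)).2 (exotic_embed (v, x)).1 b i = reaches x v b i.
Proof.
apply/reachesP/reachesP => -[z]; rewrite !block_diag_exp mul_block_col !mulmx0 mul0mx !addr0.
  rewrite -[z]vsubmxK mul_block_col mul0mx addr0 => /eq_col_mx [e _]; by exists (usubmx z).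
by move=> e; exists (col_mx z 0); rewrite mul_block_col !mulmx0 mul0mx !addr0 e.
Qed.

(** The frame of [hyperbolic_frame_exists] is a symplectic basis, and
    self-adjointness of [y] makes its two diagonal blocks transposed. *)
Theorem exotic_normal_form (p : 'cV[K]_(n + n) * 'M[K]_(n + n)) : exotic_cone p ->
  exists g v (x : 'M[K]_n), symplectic g /\ p = symp_act g (exotic_embed (v, x)).
Proof.
case: p => w y /exotic_coneP [ny alty].
have [m [E [F [c [[h1 h2 h3 [A hA] [C hC]] wE mn]]]]] :=
  hyperbolic_frame_exists alternating_symp_mx symp_mx_unit w ny alty.
have e : m = n by lia.
subst m; pose g := row_mx E F.
have gM : g^T *m symp_mx *m g = symp_mx.
  rewrite tr_row_mx !mul_col_mx !mul_mx_row h1 h2 h3.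
  have -> : E^T *m symp_mx *m F = - 1%:M.
    by rewrite (alternating_form_skew _ _ alternating_symp_mx) h3 trmx1.
  by [].
have sg := symplecticP gM.
have yg : y *m g = g *m block_mx A 0 0 C.
  by rewrite mul_mx_row hA hC mul_row_block !mulmx0 addr0 add0r.
have CA : C = A^T.
  have := alternating_congr g^T alty; rewrite trmxK.
  rewrite mulmxA -[_ *m y *m g]mulmxA yg mulmxA gM.
  rewrite mulmx_block !mul0mx !mulmx0 !add0r mulNmx !mul1mx !addr0 => -[].
  rewrite tr_block_mx opp_block_mx opprK => /eq_block_mx [_ <- _ _].
  by [].
exists g, c, A; split=> //; rewrite /symp_act /exotic_embed /= -CA -yg mulmxK //; last by case: sg.
by rewrite mul_row_col mulmx0 addr0 wE.
Qed.

End ExoticOrbit.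

Section ExoticOrbit.
Variables (K : fieldType) (n : nat) (mu nu : seq nat).
Hypothesis bip : is_bipartition_of n mu nu.
Local Notation la := (partition_add mu nu).

Lemma enhanced_orbit_nonempty : exists p, enhanced_orbit K n mu nu p.
Proof.
have sz := bipartition_sum bip.
have [x [u [nx ju]]] := @jordan_generators_of_sizes K n _ (fun i : 'I_(size la) => nth 0%N la i) sz.
exists (vector_sum x u (fun i => nth 0%N nu i), x).
apply/(enhanced_orbitP bip); split=> // [i|b i]; first exact: (rank_jordan nx ju sz).
exact: (reaches_bipartition bip).
Qed.

Lemma enhanced_orbit_conj (p q : 'cV[K]_n * 'M[K]_n) :
  enhanced_orbit K n mu nu p -> enhanced_orbit K n mu nu q ->
  exists2 g, g \in unitmx & q = (g *m p.1, g *m p.2 *m invmx g).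
Proof.
case: p q => [v x] [v' x'] /(enhanced_orbit_generators bip) [nx [u [ju ->]]].
move=> /(enhanced_orbit_generators bip) [nx' [u' [ju' ->]]].
have sz := bipartition_sum bip.
have [g gu [gx gE]] := jordan_conj nx nx' ju ju' sz; exists g => //=.
have al (i : 'I_(size la)) : (nth 0%N nu i <= nth 0%N la i)%N by rewrite nth_partition_add leq_addl.
by rewrite gx mulmxK // (vector_sum_cyclic ju al) (vector_sum_cyclic ju' al) gE.
Qed.

Lemma symplectic_diag (g : 'M[K]_n) : g \in unitmx ->
  symplectic (block_mx g 0 0 (invmx g)^T).
Proof.
move=> gu; apply: symplecticP; rewrite tr_block_mx !trmx0 trmxK !mulmx_block.
rewrite !mul0mx !mulmx0 !add0r !addr0 mulmx1 mulmxN mulmx1 mulNmx.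
by rewrite -trmx_mul mulVmx // trmx1 !mul0mx.
Qed.

Lemma symp_act_diag (g : 'M[K]_n) v (x : 'M[K]_n) : g \in unitmx ->
  symp_act (block_mx g 0 0 (invmx g)^T) (exotic_embed (v, x)) =
  exotic_embed (g *m v, g *m x *m invmx g).
Proof.
move=> gu; have [du _] := symplectic_diag gu.
rewrite /symp_act /exotic_embed /= mul_block_col !mulmx0 mul0mx !addr0; congr (_, _).
apply: (can_inj (mulmxK du)); rewrite mulmxKV // !mulmx_block !mulmx0 !mul0mx !addr0 !add0r.
by rewrite mulmxKV // -mulmxA !trmx_mul -!mulmxA -[g^T *m _]trmx_mul mulVmx // trmx1 mulmx1.
Qed.

(** The orbits of the linear group map into a single symplectic orbit since
    [g] acts on the embedded pair as the symplectic matrix with blocks [g] and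
    its inverse transpose.  Conversely a point with the right invariants is
    conjugate to an embedded pair, and the latter lies in the enhanced orbit
    because its invariants are those of the point. *)
Theorem exotic_orbitP (w : 'cV[K]_(n + n)) (y : 'M[K]_(n + n)) :
  exotic_orbit K n mu nu (w, y) <->
  [/\ exotic_cone (w, y), forall i, \rank (y ^+ i) = (profile la i).*2 &
      forall b i, reaches y w b i <-> heights mu nu b i].
Proof.
have [[v0 x0] p0] := enhanced_orbit_nonempty.
have nx0 : nilpotent_mx x0 by case: p0.
have PX : [set X | is_symp_orbit X /\
    @exotic_embed K n @` enhanced_orbit K n mu nu `<=` X]%classic (exotic_orbit K n mu nu).
  apply: xgetPex; exists [set symp_act g (exotic_embed (v0, x0)) | g in @symplectic K n]%classic.
  split; first by exists (exotic_embed (v0, x0)) => //; exact: exotic_cone_embed.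
  move=> _ [q eq <-]; have [g gu ->] := enhanced_orbit_conj p0 eq.
  exists (block_mx g 0 0 (invmx g)^T); first exact: symplectic_diag.
  exact: symp_act_diag.
have [[p cp XE] sub] := PX; rewrite XE in sub *.
have inv (g : 'M_(n + n)) (q : 'cV[K]_(n + n) * 'M_(n + n)) : symplectic g ->
    (forall i, \rank ((symp_act g q).2 ^+ i) = \rank (q.2 ^+ i)) /\
    (forall b i, reaches (symp_act g q).2 (symp_act g q).1 b i = reaches q.2 q.1 b i).
  by move=> [gu _]; split=> *; rewrite ?rank_conj ?reaches_conj.
split=> [[g sg gE] | [cwy rk hts]].
  have [g0 sg0 g0E] : [set symp_act g p | g in @symplectic K n]%classic (exotic_embed (v0, x0)).
    by apply: sub; exists (v0, x0).
  have [rk0 ht0] := inv g0 p sg0; have [rk1 ht1] := inv g p sg.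
  rewrite g0E in rk0 ht0; rewrite gE in rk1 ht1.
  have [_ r h] := (enhanced_orbitP bip _ _).1 p0.
  split=> [|i|b i].
  - by rewrite -gE; apply: exotic_cone_act.
  - by rewrite -[y]/((w, y).2) rk1 -rk0 rank_embed r.
  - by rewrite -[y]/((w, y).2) -[w]/((w, y).1) ht1 -ht0 reaches_embed.
have [g [v [x [sg gE]]]] := exotic_normal_form cwy.
have [rk1 ht1] := inv g (exotic_embed (v, x)) sg; rewrite -gE in rk1 ht1.
have ev : enhanced_orbit K n mu nu (v, x).
  apply/(enhanced_orbitP bip); split=> [|i|b i].
  - have [ny _] := (exotic_coneP _ _).1 cwy; apply: (nilpotent_embed v x).1.
    have := nilpotent_conj (g := invmx g) _ ny; case: sg => gu _.
    rewrite unitmx_inv gu => /(_ isT); have -> : y = (symp_act g (exotic_embed (v, x))).2 by rewrite -gE.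
    by rewrite invmxK /symp_act [(_, _).2]/= !mulmxA mulVmx // mul1mx mulmxKV.
  - by apply: double_inj; rewrite -rk -(rank_embed v) -rk1.
  - by rewrite -hts -[reaches y w b i]/(reaches (w, y).2 (w, y).1 b i) ht1 reaches_embed.
have [g' sg' g'E] : [set symp_act g p | g in @symplectic K n]%classic (exotic_embed (v, x)).
  by apply: sub; exists (v, x).
exists (g *m g'); first exact: symplecticM.
by rewrite symp_actM ?g'E ?gE //; [case: sg | case: sg'].
Qed.

End ExoticOrbit.

(** * Counting matrices row by row *)
Section RankLemmas.
Variable (K : fieldType).

Lemma mxrank_col_rV k N (v : 'rV[K]_N) (P : 'M[K]_(k, N)) :
  \rank (col_mx v P) = (~~ (v <= P)%MS + \rank P)%N.
Proof.
rewrite -addsmxE; case: (boolP (v <= P)%MS) => [vP|nvP] /=.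
  by rewrite (addsmx_idPr vP).
have rv : \rank v = 1%N.
  by rewrite rank_rV; case: eqP nvP => // ->; rewrite sub0mx.
have := mxrank_sum_cap v P; rewrite rv => <-.
suff -> : \rank (v :&: P)%MS = 0%N by rewrite addn0.
suff : (\rank (v :&: P)%MS < \rank v)%N by rewrite rv ltnS leqn0 => /eqP.
rewrite ltn_neqAle mxrankS ?capmxSl // andbT.
have /mxrank_leqif_sup [_ ->] := capmxSl v P.
by apply: contra nvP => h; apply: submx_trans h (capmxSr _ _).
Qed.

Lemma row_free_col_rV k N (v : 'rV[K]_N) (P : 'M[K]_(k, N)) :
  row_free (col_mx v P : 'M_(1 + k, N)) = row_free P && ~~ (v <= P)%MS.
Proof.
rewrite /row_free mxrank_col_rV; case: (v <= P)%MS => /=; last by rewrite andbT eqSS.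
rewrite andbF; apply/eqP => e; have := rank_leq_row P.
by rewrite -[\rank P]add0n e ltnn.
Qed.

Lemma alternating_block k (b : 'rV[K]_k) (e' : 'M[K]_k) (a : 'M_1) (c : 'cV_k) :
  alternating (block_mx a b c e' : 'M_(1 + k)) <->
  [/\ a = 0, c = - b^T & alternating e'].
Proof.
split=> [[]|[-> -> [sk dg]]].
  rewrite tr_block_mx opp_block_mx => /eq_block_mx [_ cb bc sk] dg; split.
  - by apply/matrixP => i j; rewrite !ord1 mxE; have := dg (lshift k 0); rewrite block_mxEul.
  - by rewrite bc opprK.
  - by split=> // i; have := dg (rshift 1 i); rewrite block_mxEdr.
split.
  by rewrite tr_block_mx opp_block_mx linearN /= trmxK sk oppr0 opprK trmx0.
move=> i; case: (split_ordP i) => j ->.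
  by rewrite block_mxEul mxE.
by rewrite block_mxEdr dg.
Qed.

(** Bordering an alternating matrix either keeps its rank, when the new row can
    be cleared by a congruence, or increases it by two. *)
Lemma mxrank_alternating_block k (b : 'rV[K]_k) (e' : 'M[K]_k) : alternating e' ->
  \rank (block_mx 0 b (- b^T) e' : 'M_(1 + k)) =
  if (b <= e')%MS then \rank e' else (\rank e').+2.
Proof.
move=> alt; have sk := proj1 alt.
have rk1 : \rank (row_mx (- b^T) e') = (~~ (b <= e')%MS + \rank e')%N.
  rewrite -mxrank_tr tr_row_mx mxrank_col_rV mxrank_tr linearN /= trmxK sk.
  by rewrite !eqmx_opp.
rewrite /block_mx mxrank_col_rV rk1.
case: (boolP (b <= e')%MS) => [/submxP [c bE]|nb] /=.
  suff -> : (row_mx 0 b <= row_mx (- b^T) e')%MS by [].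
  apply/submxP; exists c; rewrite mul_mx_row -bE; congr row_mx.
  rewrite bE trmx_mul sk mulNmx opprK mulmxA.
  have [_ dz] : alternating (c *m e' *m c^T) by apply: alternating_congr.
  by apply/matrixP => i j; rewrite !ord1 dz mxE.
suff -> : (row_mx 0 b <= row_mx (- b^T) e')%MS = false by [].
apply: contraNF nb => /submxP [c]; rewrite mul_mx_row => /eq_row_mx [_ ->].
exact: submxMl.
Qed.

End RankLemmas.

Section RowExtension.
Variable F : finFieldType.
Local Notation q := #|F|.

Lemma card_col_mx k N (A : pred 'M[F]_(1 + k, N)) :
  #|A| = (\sum_(P : 'M[F]_(k, N)) #|[pred v : 'rV_N | A (col_mx v P)]|)%N.
Proof.
rewrite -sum1_card (partition_big (fun P : 'M_(1 + k, N) => dsubmx P) predT) //=.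
apply: eq_bigr => P _.
rewrite (reindex_onto (fun v : 'rV_N => col_mx v P) usubmx) /=; last first.
  by move=> M /andP [_ /eqP <-]; rewrite vsubmxK.
rewrite -sum1_card; apply: eq_bigl => v.
by rewrite inE col_mxKd col_mxKu !eqxx !andbT.
Qed.

Lemma card_affine N c (C : 'M[F]_(N, c)) (b : 'rV_c) :
  #|[pred v : 'rV_N | v *m C == b]| = if (b <= C)%MS then (q ^ (N - \rank C))%N else 0%N.
Proof.
case: ifP => [/submxP [v0 ->]|nb]; last first.
  by apply: eq_card0 => v; rewrite !inE; apply: contraFF nb => /eqP <-; apply: submxMl.
rewrite -mxrank_ker -card_rowg -(card_imset (mem (rowg (kermx C))) (addrI v0)).
apply: eq_card => v; rewrite !inE; apply/eqP/imsetP => [e|[u]].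
  exists (v - v0); last by rewrite addrC subrK.
  by rewrite mem_rowg; apply/sub_kermxP; rewrite mulmxBl e subrr.
by rewrite mem_rowg => /sub_kermxP e ->; rewrite mulmxDl e addr0.
Qed.

(** The rows to be discarded, those in the span of [P], are parametrized by
    their coordinates because [P] is row free. *)
Lemma card_new_row k N c (P : 'M[F]_(k, N)) (C : 'M[F]_(N, c)) (b : 'rV_c) :
  row_free P ->
  #|[pred v : 'rV_N | (v *m C == b) && ~~ (v <= P)%MS]| =
  (#|[pred v : 'rV_N | v *m C == b]| - #|[pred r : 'rV_k | r *m (P *m C) == b]|)%N.
Proof.
move=> fP; rewrite -(cardID (mem [pred v : 'rV_N | (v <= P)%MS]) [pred v : 'rV_N | v *m C == b]).
rewrite -(card_imset [pred r : 'rV_k | r *m (P *m C) == b] (row_free_inj fP)).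
rewrite [X in (X + _ - _)%N](_ : _ = #|[set r *m P | r in [pred r : 'rV_k | r *m (P *m C) == b]]%SET|).
  by rewrite addKn; apply: eq_card => v; rewrite !inE andbC.
apply: eq_card => v; rewrite !inE; apply/andP/imsetP => [[e /submxP [r vE]]|[r]].
  by exists r; rewrite // inE mulmxA -vE.
by rewrite inE mulmxA => e ->; rewrite submxMl.
Qed.

End RowExtension.

Section Numbers.
Local Open Scope nat_scope.

(** Number of row free [k]-row matrices with a prescribed product, of rank [s],
    with a matrix of full column rank and [N]-dimensional left kernel over a
    field with [q] elements.  For [s = 0] it counts injections; if moreover
    [k = N], it is the order of the general linear group. *)
Definition lift_number q N k s := q ^ (N * s) * \prod_(i < k - s) (q ^ N - q ^ i).

Variable q : nat.


(** Number of isometric embeddings, in a symplectic space of dimension [2 n],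
    of a space of dimension [2 s + a] with a form of rank [2 s].  For
    [a = 0] and [s = n] it is the order of the symplectic group. *)
Definition isometry_number n a s :=
  (\prod_(i < s) ((q ^ (n - i).*2 - 1) * q ^ ((n - i).*2 - 1))) *
  \prod_(i < a) (q ^ ((n - s).*2 - i) - q ^ i).

Lemma subX_factor m i : i.*2 <= m -> q ^ (m - i) - q ^ i = q ^ i * (q ^ (m - i.*2) - 1).
Proof. by move=> h; rewrite mulnBr muln1 -expnD; congr (q ^ _ - _); lia. Qed.

Lemma isotropic_productE m a : a <= m ->
  \prod_(i < a) (q ^ (m.*2 - i) - q ^ i) =
  q ^ (\sum_(i < a) i) * \prod_(i < a) (q ^ (m - i).*2 - 1).
Proof.
move=> am; rewrite expn_sum -big_split; apply: eq_bigr => i _ /=.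
by rewrite subX_factor ?doubleB //; have := ltn_ord i; lia.
Qed.

Lemma lift_productE m a : a <= m ->
  \prod_(i < a) ((q ^ 2) ^ m - (q ^ 2) ^ i) =
  q ^ (\sum_(i < a) i).*2 * \prod_(i < a) (q ^ (m - i).*2 - 1).
Proof.
move=> am; have -> : (\sum_(i < a) i).*2 = \sum_(i < a) i.*2.
  by rewrite -muln2 big_distrl; apply: eq_bigr => i _; rewrite /= muln2.
rewrite expn_sum -big_split; apply: eq_bigr => i _ /=.
by rewrite -!expnM !mul2n mulnBr muln1 -expnD; congr (q ^ _ - _); have := ltn_ord i; lia.
Qed.

Lemma hyperbolic_productE n s : s <= n ->
  \prod_(i < s) ((q ^ (n - i).*2 - 1) * q ^ ((n - i).*2 - 1)) =
  q ^ (s * (n.*2 - s)) * \prod_(i < s) (q ^ (n - i).*2 - 1).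
Proof.
move=> sn; rewrite big_split mulnC; congr (_ * _) => /=.
rewrite -expn_sum; congr (q ^ _).
elim: s sn => [|s IH] sn; first by rewrite big_ord0.
by rewrite big_ord_recr /= IH ?(ltnW sn) //; nia.
Qed.

Lemma isometry_number_recl n a s :
  isometry_number n a.+1 s = isometry_number n a s * (q ^ ((n - s).*2 - a) - q ^ a).
Proof. by rewrite /isometry_number big_ord_recr /= mulnA. Qed.

(** The number of ways of adding a vector that pairs nontrivially with the
    radical: this lowers the dimension [a.+1] of the radical by one and raises
    the rank by two. *)
Lemma isometry_number_recr n a s : s + a.+1 <= n ->
  isometry_number n a s.+1 = isometry_number n a.+1 s * q ^ ((n - s).*2 - a.+1).
Proof.
move=> le; rewrite /isometry_number !hyperbolic_productE; try lia.
rewrite !isotropic_productE; try lia.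
rewrite [X in _ = q ^ _ * _ * (q ^ X * _) * _]big_ord_recr /= big_ord_recr.
rewrite [X in _ = _ * (_ * X) * _]big_ord_recl /= subn0.
have -> : \prod_(i < a) (q ^ (n - s - bump 0 i).*2 - 1) = \prod_(i < a) (q ^ (n - s.+1 - i).*2 - 1).
  by apply: eq_bigr => i _; congr (q ^ _ - 1); rewrite /bump; lia.
set A := \prod_(i < s) _; set B := \prod_(i < a) _; set S := \sum_(i < a) _; set G := q ^ (n - s).*2 - 1.
have -> : q ^ (s.+1 * (n.*2 - s.+1)) = q ^ (s * (n.*2 - s)) * (q ^ a * q ^ ((n - s).*2 - a.+1)).
  rewrite -!expnD; congr (q ^ _).
  have [r ->] : exists r, n = s + a.+1 + r by exists (n - (s + a.+1)); lia.
  have -> : (s + a.+1 + r).*2 - s.+1 = s + a.*2 + r.*2 + 1 by lia.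
  have -> : (s + a.+1 + r).*2 - s = s + a.*2 + r.*2 + 2 by lia.
  have -> : (s + a.+1 + r - s).*2 - a.+1 = a + r.*2 + 1 by lia.
  rewrite -!addnn; ring.
by rewrite expnD; ring.
Qed.

Lemma sum_ord_double a : (\sum_(i < a) i).*2 + a = a * a.
Proof.
elim: a => [|a IH]; rewrite ?big_ord0 // big_ord_recr /=; move: IH.
by move: (\sum_(i < a) i) => x; nia.
Qed.

(** The transition factors of the two recursions agree.  Both sides are a power
    of [q] times a product of terms [q ^ (2 i) - 1], which are the terms
    [Q ^ i - 1] for [Q = q ^ 2]. *)
Lemma isometry_lift_number n m s : s <= m -> m <= n -> m - s <= n - m ->
  @isometry_number n (m - s).*2 s * lift_number (q ^ 2) m m 0 =
  @isometry_number m 0 m * (lift_number (q ^ 2) n m 0 * lift_number (q ^ 2) (n - m) m s).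
Proof.
move=> sm mn; set a := m - s; have mE : m = s + a by rewrite subnKC.
move=> an; rewrite /isometry_number /lift_number !muln0 !expn0 !mul1n !subn0 subnn big_ord0 muln1.
rewrite -/a !hyperbolic_productE // ?(leq_trans sm) // isotropic_productE; last by lia.
rewrite !lift_productE //.
have -> : \prod_(i < a.*2) (q ^ (n - s - i).*2 - 1) =
  \prod_(i < a) (q ^ (n - s - i).*2 - 1) * \prod_(i < a) (q ^ (n - m - i).*2 - 1).
  rewrite -addnn big_split_ord /=; congr (_ * _); apply: eq_bigr => i _.
  by congr (q ^ _ - 1); lia.
have -> : \prod_(i < m) (q ^ (n - i).*2 - 1) =
  \prod_(i < s) (q ^ (n - i).*2 - 1) * \prod_(i < a) (q ^ (n - s - i).*2 - 1).
  rewrite [in LHS]mE big_split_ord /=; congr (_ * _); apply: eq_bigr => i _.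
  by congr (q ^ _ - 1); lia.
set A := \prod_(i < s) _; set B := \prod_(i < a) _; set C := \prod_(i < a) _; set D := \prod_(i < m) _.
set S := (\sum_(i < m) i).*2.
have e : q ^ (s * (n.*2 - s)) * q ^ (\sum_(i < a.*2) i) =
  q ^ (m * (m.*2 - m)) * (q ^ 2) ^ ((n - m) * s) * q ^ (\sum_(i < a) i).*2.
  rewrite -expnM -!expnD; congr (q ^ _).
  have [r nE] : exists r, n = m + r by exists (n - m); lia.
  have := sum_ord_double a.*2; have := sum_ord_double a.
  move: (\sum_(i < a) i) (\sum_(i < a.*2) i) => x y h1 h2.
  have -> : n.*2 - s = s + a.*2 + r.*2 by lia.
  have -> : m.*2 - m = m by lia.
  have -> : n - m = r by lia.
  rewrite mE; nia.
transitivity ((q ^ (s * (n.*2 - s)) * q ^ (\sum_(i < a.*2) i)) * (A * (B * C) * (q ^ S * D))); first by ring.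
by rewrite e; ring.
Qed.

Lemma isometry_number_gt0 n : 1 < q -> 0 < isometry_number n 0 n.
Proof.
move=> q1; rewrite /isometry_number big_ord0 muln1 prodn_gt0 // => i; have := ltn_ord i => lt.
rewrite muln_gt0 expn_gt0 (ltnW q1) andbT subn_gt0 -{1}(expn0 q) ltn_exp2l //; lia.
Qed.

Lemma lift_number_gt0 m : 1 < q -> 0 < lift_number q m m 0.
Proof.
move=> q1; rewrite /lift_number muln0 mul1n subn0 prodn_gt0 // => i.
by rewrite subn_gt0 ltn_exp2l.
Qed.

End Numbers.

Section MatrixCounts.
Variable F : finFieldType.
Local Notation q := #|F|.

Lemma eq_col_mxE m1 m2 n (A A' : 'M[F]_(m1, n)) (B B' : 'M[F]_(m2, n)) :
  (col_mx A B == col_mx A' B') = (A == A') && (B == B').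
Proof.
by apply/eqP/andP => [/eq_col_mx [-> ->]|[/eqP -> /eqP ->]].
Qed.

(** A common form of adding a row [v] to [P]: linear conditions on [v], and [v]
    outside of the span of [P].  The discarded solutions are counted by the
    same affine system restricted to this span. *)
Lemma card_extend k N c r (A : pred 'M[F]_(k, N)) (B : pred 'M[F]_(1 + k, N))
    (C : 'M[F]_(k, N) -> 'M[F]_(N, c)) (b : 'rV_c) (z : 'M[F]_(k, c)) :
  (forall v P, B (col_mx v P) = [&& A P, v *m C P == b & ~~ (v <= P)%MS]) ->
  (forall P, A P -> [/\ row_free P, P *m C P = z, (b <= C P)%MS & \rank (C P) = r]) ->
  #|B| = (#|A| * (q ^ (N - r) - (if (b <= z)%MS then q ^ (k - \rank z) else 0)))%N.
Proof.
move=> BE AE; rewrite card_col_mx -sum1_card big_distrl /= [RHS]big_mkcond.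
apply: eq_bigr => P _; rewrite -[P \in A]/(A P) mul1n.
case: (boolP (A P)) => AP; last by apply: eq_card0 => v; rewrite inE BE (negPf AP).
have [fP PC bC rC] := AE P AP.
rewrite -card_affine -PC -rC.
have -> : (q ^ (N - \rank (C P)) = #|[pred v : 'rV_N | v *m C P == b]|)%N by rewrite card_affine bC.
by rewrite -card_new_row //; apply: eq_card => v; rewrite !inE BE AP.
Qed.

Lemma mx_no_rows_eq m n (A B : 'M[F]_(m, n)) : m = 0%N -> A = B.
Proof. by move=> e; subst m; apply/matrixP => -[]. Qed.

Lemma row_free0 N (P : 'M[F]_(0, N)) : row_free P.
Proof. by rewrite /row_free -leqn0 rank_leq_row. Qed.

Lemma card_all0 N (A : pred 'M[F]_(0, N)) : A 0 -> #|A| = 1%N.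
Proof.
move=> A0; rewrite (eq_card (B := predT)) => [|P]; first by rewrite card_mx mul0n.
by rewrite [P](_ : P = 0) //; apply: mx_no_rows_eq.
Qed.

Lemma card_lift k N c (C : 'M[F]_(N, c)) (z : 'M[F]_(k, c)) : row_full C ->
  #|[pred P : 'M_(k, N) | row_free P && (P *m C == z)]| = lift_number q (N - c) k (\rank z).
Proof.
move=> fC; have rC := eqP fC.
elim: k z => [|k IH] z.
  rewrite card_all0 /=; last by rewrite row_free0 mul0mx; apply/eqP; apply: mx_no_rows_eq.
  have -> : \rank z = 0%N by apply/eqP; rewrite -leqn0 rank_leq_row.
  by rewrite /lift_number muln0 mul1n big_ord0.
rewrite -[z](vsubmxK (z : 'M_(1 + k, c))); set b := usubmx _; set z' := dsubmx _.
have -> : #|[pred P : 'M_(1 + k, N) | row_free P && (P *m C == col_mx b z')]| =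
  (#|[pred P : 'M_(k, N) | row_free P && (P *m C == z')]| *
   (q ^ (N - c) - (if (b <= z')%MS then q ^ (k - \rank z') else 0)))%N.
  apply: (@card_extend k N c c _ _ (fun=> C)).
    move=> v P /=; rewrite row_free_col_rV mul_col_mx eq_col_mxE.
    by case: (row_free P) => //=; case: (v *m C == b); case: (P *m C == z'); rewrite /= ?andbT ?andbF.
  by move=> P /andP [fP /eqP PC]; split=> //; exact: submx_full.
rewrite IH mxrank_col_rV; have le := rank_leq_row z'.
rewrite /lift_number; case: (b <= z')%MS => /=.
  by rewrite add0n subSn // big_ord_recr /= mulnA.
by rewrite add1n subSS subn0 mulnS expnD; lia.
Qed.

(** The bound on [k] keeps the subtractions in [isometry_number] exact; it says
    that the isometric embedding exists. *)
Lemma card_isometry n k (J : 'M[F]_(n + n)) (eta : 'M[F]_k) :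
  alternating J -> J \in unitmx -> alternating eta ->
  exists s, \rank eta = s.*2 /\ (k <= n + s ->
    #|[pred P : 'M_(k, n + n) | row_free P && (P *m J *m P^T == eta)]| =
    isometry_number q n (k - s.*2) s)%N.
Proof.
move=> altJ uJ; elim: k eta => [|k IH] eta alt.
  exists 0%N; split; first by apply/eqP; rewrite -leqn0 rank_leq_row.
  move=> _; rewrite card_all0 /=; last by rewrite row_free0 linear0 mulmx0; apply/eqP; apply: mx_no_rows_eq.
  by rewrite /isometry_number !big_ord0.
move: alt; rewrite -[eta](submxK (eta : 'M_(1 + k))).
set b := ursubmx _; set e' := drsubmx _ => /alternating_block [-> -> alt'].
have [s [rk cnt]] := IH e' alt'.
have rec : #|[pred P : 'M_(1 + k, n + n) | row_free P && (P *m J *m P^T == block_mx 0 b (- b^T) e')]| =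
  (#|[pred P : 'M_(k, n + n) | row_free P && (P *m J *m P^T == e')]| *
   (q ^ ((n + n) - k) - (if (b <= e')%MS then q ^ (k - \rank e') else 0)))%N.
  apply: (@card_extend k (n + n) k k _ _ (fun P => J *m P^T)).
    move=> v P /=; rewrite row_free_col_rV tr_col_mx mul_col_mx mul_col_row.
    have [_ dz] := alternating_congr v altJ.
    have -> : v *m J *m v^T = 0 by apply/matrixP => i j; rewrite !ord1 dz mxE.
    have -> : P *m J *m v^T = - (v *m J *m P^T)^T.
      by have := alternating_form_skew P^T v^T altJ; rewrite !trmxK.
    case: (row_free P) => //=; rewrite mulmxA.
    apply/andP/and3P => [[vP /eqP /eq_block_mx [_ <- _ ->]]|[/eqP -> /eqP -> vP]] //.
  move=> P /andP [fP /eqP PJ].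
  have fC : \rank (J *m P^T) = k.
    rewrite -mxrank_tr trmx_mul trmxK mxrankMfree ?(eqP fP) //.
    by rewrite row_free_unit unitmx_tr.
  split; rewrite ?mulmxA //.
  by apply: submx_full; rewrite /row_full fC.
have le : (s.*2 <= k)%N by rewrite -rk rank_leq_row.
rewrite mxrank_alternating_block //; move: rec; case: ifP => be rec.
  exists s; split=> // ks; rewrite rec cnt; last exact: ltnW.
  rewrite rk subSn // isometry_number_recl; congr (_ * (_ ^ _ - _))%N; lia.
exists s.+1; split; first by rewrite rk doubleS.
move=> ks; rewrite rec cnt; last by lia.
have lt : (s.*2 < k)%N.
  rewrite ltn_neqAle le andbT; apply: contraFN be => /eqP e.
  by apply: submx_full; rewrite /row_full rk e.
rewrite subn0 -(subnSK lt) isometry_number_recr; last by lia.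
have -> : (k.+1 - s.+1.*2 = k - s.*2.+1)%N by lia.
by congr (_ * _ ^ _)%N; lia.
Qed.

End MatrixCounts.

(** * The shift recursions *)
Lemma card_fibers (T X : finType) (P : pred T) (h : T -> X) (D : pred X) c :
  (forall t, P t -> D (h t)) ->
  (forall x, D x -> #|[pred t | P t && (h t == x)]| = c) -> (#|P| = #|D| * c)%N.
Proof.
move=> Dh Dc; rewrite -[LHS]sum1_card (partition_big h D) //= -sum_nat_const.
by apply: eq_bigr => x Dx; rewrite -(Dc x Dx) -sum1_card.
Qed.

Lemma double_count (T I J : finType) (P : pred T) (f : T -> I) (g : T -> J)
    (A : pred I) (B : pred J) a b :
  (forall t, P t -> A (f t)) -> (forall t, P t -> B (g t)) ->
  (forall i, A i -> #|[pred t | P t && (f t == i)]| = a) ->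
  (forall j, B j -> #|[pred t | P t && (g t == j)]| = b) ->
  (#|A| * a = #|B| * b)%N.
Proof. by move=> Af Bg fA gB; rewrite -(card_fibers Af fA) -(card_fibers Bg gB). Qed.

Section Factorization.
Variable K : fieldType.

(** This is why passing from [A *m B] to [B *m A] shifts the ranks of powers
    when [A] and [B] have full rank. *)
Lemma mulmx_exp_rotate n m (A : 'M[K]_(n, m)) (B : 'M[K]_(m, n)) i :
  (A *m B) ^+ i.+1 = A *m (B *m A) ^+ i *m B.
Proof.
elim: i => [|i IH]; first by rewrite expr1 mulmx1.
by rewrite exprS IH [(B *m A) ^+ i.+1]exprS -!mulmxE !mulmxA.
Qed.

Lemma mxrank_mul_full n m p r (A : 'M[K]_(n, m)) (Z : 'M_(m, p)) (B : 'M[K]_(p, r)) :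
  row_free A^T -> row_free B -> \rank (A *m Z *m B) = \rank Z.
Proof.
by move=> fA fB; rewrite mxrankMfree // -mxrank_tr trmx_mul mxrankMfree // mxrank_tr.
Qed.

Lemma mxrank_unitl n p (A : 'M[K]_n) (B : 'M[K]_(n, p)) : A \in unitmx ->
  \rank (A *m B) = \rank B.
Proof.
move=> uA; rewrite -mxrank_tr trmx_mul mxrankMfree ?mxrank_tr //.
by rewrite row_free_unit unitmx_tr.
Qed.

Lemma rank_factorization n m (x : 'M[K]_n) : \rank x = m ->
  exists (A : 'M_(n, m)) (B : 'M_(m, n)), [/\ row_free A^T, row_free B & x = A *m B].
Proof.
move=> <-; exists (col_base x), (row_base x); rewrite row_base_free mulmx_base.
by split=> //; rewrite /row_free mxrank_tr; exact: col_base_full.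
Qed.

(** An alternating form is pulled back from a nondegenerate one on the quotient
    by its radical. *)
Lemma alternating_factorization N m (B : 'M[K]_N) : alternating B -> \rank B = m ->
  exists (P : 'M_(m, N)) (B0 : 'M_m),
    [/\ row_free P, alternating B0, B0 \in unitmx & B = P^T *m B0 *m P].
Proof.
move=> altB rB; have [A [P [fA fP BE]]] := rank_factorization rB.
have /row_freeP [X PX] := fP.
have BXP : B *m X *m P = B by rewrite BE -!mulmxA (mulmxA P) PX mul1mx.
have altB0 := alternating_congr X^T altB; rewrite trmxK in altB0.
have E : B = P^T *m (X^T *m B *m X) *m P.
  rewrite -mulmxA -[X^T *m B *m X *m P]mulmxA -[X^T *m B *m (X *m P)]mulmxA.
  rewrite [B *m (X *m P)]mulmxA BXP mulmxA -trmx_mul -[B in RHS]opprK -(proj1 altB).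
  by rewrite mulmxN -trmx_mul mulmxA BXP (proj1 altB) opprK.
exists P, (X^T *m B *m X); split=> //.
rewrite -row_free_unit /row_free; apply/eqP; apply: etrans rB.
by rewrite [in RHS]E [RHS]mxrank_mul_full ?trmxK.
Qed.

End Factorization.

Section Recursions.
Variable F : finFieldType.
Local Notation q := #|F|.

Definition nilpotent_count n (rho : nat -> nat) :=
  #|[pred x : 'M[F]_n | `[< forall i, \rank (x ^+ i) = rho i >]]|.

(** Counts the full rank pairs [(A, B)] in two ways: those with given [A *m B]
    form a torsor under the linear group, and those with given [B *m A] are
    found by choosing [B] and then lifting through it. *)
Lemma nilpotent_count_rec n m (rho : nat -> nat) : rho 0%N = n -> rho 1%N = m ->
  (nilpotent_count n rho * lift_number q m m 0 =
   nilpotent_count m (fun i => rho i.+1) *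
     (lift_number q n m 0 * lift_number q (n - m) m (rho 2)))%N.
Proof.
move=> r0 r1.
pose P := [pred AB : 'M[F]_(n, m) * 'M[F]_(m, n) | [&& row_free AB.1^T, row_free AB.2 &
  `[< forall i, \rank ((AB.2 *m AB.1) ^+ i) = rho i.+1 >]]].
have cfree k N : #|[pred X : 'M[F]_(k, N) | row_free X]| = lift_number q N k 0.
  have full0 : row_full (0 : 'M[F]_(N, 0)) by rewrite /row_full mxrank0.
  have := card_lift (0 : 'M_(k, 0)) full0; rewrite mxrank0 subn0 => <-.
  by apply: eq_card => X; rewrite !inE mulmx0 eqxx andbT.
apply: (@double_count _ _ _ P (fun AB => AB.1 *m AB.2) (fun AB => AB.2 *m AB.1)).
- move=> [A B] /and3P [/= fA fB /asboolP rk]; apply/asboolP => -[|i].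
    by rewrite expr0 r0; exact: mxrank1.
  by rewrite mulmx_exp_rotate mxrank_mul_full.
- by move=> [A B] /and3P [_ _ /asboolP rk]; apply/asboolP.
- move=> x /asboolP rk.
  have rx : \rank x = m by rewrite -[x]expr1 rk.
  have [A0 [B0 [fA fB xE]]] := rank_factorization rx.
  rewrite -cfree -(card_in_imset (f := fun g => (A0 *m invmx g, g *m B0))); last first.
    by move=> g h _ _ [_ /(row_free_inj fB)].
  apply: eq_card => -[A B]; rewrite !inE /=.
  apply/andP/imsetP => [[/and3P [/= fA1 fB1 _] /eqP ABx]|[g]].
    have /row_freeP [Y AY] := fA1.
    have YA : Y^T *m A = 1%:M by rewrite -[A]trmxK -trmx_mul AY trmx1.
    pose g := Y^T *m A0; have gB : B = g *m B0.
      by rewrite -mulmxA -xE -ABx mulmxA YA mul1mx.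
    have gu : g \in unitmx.
      by rewrite -row_free_unit /row_free -(mxrankMfree _ fB) -gB.
    exists g; first by rewrite inE row_free_unit.
    congr (_, _) => //; apply: (can_inj (mulmxK gu)); rewrite mulmxKV //.
    by apply: (row_free_inj fB); rewrite -mulmxA -gB ABx.
  rewrite inE row_free_unit => gu [-> ->].
  have xgE : A0 *m invmx g *m (g *m B0) = x by rewrite mulmxA mulmxKV.
  rewrite xgE eqxx; split=> //.
  have fA1 : row_free (A0 *m invmx g)^T.
    by rewrite trmx_mul /row_free mxrankMfree // mxrank_unit // unitmx_tr unitmx_inv.
  have fB1 : row_free (g *m B0) by rewrite /row_free mxrankMfree // mxrank_unit.
  apply/and3P; split=> //; apply/asboolP => i; rewrite -rk.
  by rewrite -(mxrank_mul_full _ fA1 fB1) -mulmx_exp_rotate xgE.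
- move=> z /asboolP rk.
  rewrite -cfree; apply: (@card_fibers _ _ _ snd) => [[A B] /andP [/and3P []] //|B /= fB].
  have fullB : row_full B^T by rewrite /row_full mxrank_tr.
  have := card_lift z^T fullB; rewrite mxrank_tr.
  rewrite (_ : \rank z = rho 2%N); last by rewrite -[z]expr1 rk.
  move=> <-; rewrite -(card_imset (f := fun X : 'M_(m, n) => (X^T, B))); last first.
    by move=> X Y [] /trmx_inj.
  apply: eq_card => -[A B']; rewrite !inE /=; apply/andP/imsetP.
    move=> [/andP [/and3P [/= fA _ _] /eqP BA] /eqP BE]; rewrite BE in BA *.
    by exists A^T; rewrite ?trmxK // inE fA -trmx_mul BA eqxx.
  move=> [X]; rewrite inE => /andP [fX /eqP XB] [-> ->].
  have BX : B *m X^T = z by apply: trmx_inj; rewrite trmx_mul trmxK.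
  rewrite trmxK fX fB BX !eqxx; split=> //; rewrite andbT; exact/asboolP.
Qed.

(** [J *m B] is the endomorphism [y], where [B] is the alternating matrix of the
    form [<y u, v>] and [J] is the inverse of the symplectic form. *)
Definition exotic_count n (J : 'M[F]_(n + n)) (rho : nat -> nat) :=
  #|[pred B : 'M[F]_(n + n) |
     `[< alternating B /\ forall i, \rank ((J *m B) ^+ i) = (rho i).*2 >]]|.

(** Counts the full rank [X] in two ways: those with given [X^T *m J' *m X] are
    the isometries between two symplectic forms, and those with given
    [X *m J *m X^T] are isometric embeddings. *)
Lemma exotic_count_rec n m (J : 'M[F]_(n + n)) (J' : 'M[F]_(m + m)) (rho : nat -> nat) :
  alternating J -> J \in unitmx -> alternating J' -> J' \in unitmx ->
  rho 0%N = n -> rho 1%N = m -> (m + m <= n + rho 2)%N ->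
  (exotic_count J rho * isometry_number q m 0 m =
   exotic_count J' (fun i => rho i.+1) * isometry_number q n (m - rho 2).*2 (rho 2))%N.
Proof.
move=> altJ uJ altJ' uJ' r0 r1 r2.
have PT (X : 'M[F]_(m + m, n + n)) : row_free X -> row_free (J *m X^T)^T.
  move=> fX; rewrite trmx_mul trmxK /row_free mxrankMfree ?row_free_unit ?unitmx_tr //.
have PJ (X : 'M[F]_(m + m, n + n)) : row_free X -> row_free (J' *m X).
  by move=> fX; rewrite /row_free mxrankMfree // mxrank_unit.
have rot (X : 'M[F]_(m + m, n + n)) i : row_free X ->
    \rank ((J *m (X^T *m J' *m X)) ^+ i.+1) = \rank ((J' *m (X *m J *m X^T)) ^+ i).
  move=> fX; rewrite -[X^T *m J' *m X]mulmxA mulmxA mulmx_exp_rotate mxrank_mul_full ?PT ?PJ //.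
  by rewrite -!mulmxA.
pose P := [pred X : 'M[F]_(m + m, n + n) | row_free X &&
  `[< forall i, \rank ((J' *m (X *m J *m X^T)) ^+ i) = (rho i.+1).*2 >]].
apply: (@double_count _ _ _ P (fun X => X^T *m J' *m X) (fun X => X *m J *m X^T)).
- move=> X /andP [fX /asboolP rk]; apply/asboolP; split.
    by have := alternating_congr X^T altJ'; rewrite trmxK.
  move=> [|i]; last by rewrite rot // rk.
  by rewrite expr0 r0 -addnn; exact: mxrank1.
- move=> X /andP [fX /asboolP rk]; apply/asboolP; split=> //; exact: alternating_congr.
- move=> B /asboolP [altB rk].
  have rB : \rank B = (m + m)%N.
    by have := rk 1%N; rewrite expr1 r1 mxrank_unitl // => ->; rewrite addnn.
  have [P0 [B0 [fP0 altB0 uB0 BE]]] := alternating_factorization altB rB.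
  have [s [rs]] := card_isometry altJ' uJ' altB0.
  have -> : s = m by apply: double_inj; rewrite -rs mxrank_unit // addnn.
  rewrite leqnn (_ : m + m - m.*2 = 0)%N; last by rewrite addnn subnn.
  move=> /(_ isT) <-.
  rewrite -(card_imset (f := fun h : 'M_(m + m) => h^T *m P0)); last first.
    by move=> h h' /(row_free_inj fP0) /trmx_inj.
  apply: eq_card => X; rewrite !inE; apply/andP/imsetP.
    move=> [/andP [fX _] /eqP XE].
    have fXT : row_free (X^T *m J')^T.
      by rewrite trmx_mul trmxK /row_free mxrankMfree // mxrank_unit // unitmx_tr.
    have /row_freeP [Y XY] := fXT.
    have YX : Y^T *m (X^T *m J') = 1%:M by rewrite -[X^T *m J']trmxK -trmx_mul XY trmx1.
    pose g := Y^T *m P0^T *m B0; have gX : X = g *m P0.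
      by rewrite -[LHS]mul1mx -YX -mulmxA XE BE /g !mulmxA.
    exists g^T; last by rewrite trmxK.
    have gu : g^T \in unitmx.
      by rewrite unitmx_tr -row_free_unit /row_free -(mxrankMfree _ fP0) -gX.
    rewrite inE row_free_unit gu trmxK /=; apply/eqP.
    apply: (row_free_inj fP0); apply: trmx_inj; apply: (row_free_inj fP0).
    have := BE; rewrite -XE gX => e; apply: trmx_inj.
    rewrite !trmx_mul !trmxK in e *.
    by rewrite !mulmxA in e *.
  move=> [h]; rewrite inE row_free_unit => /andP [hu /eqP hE] ->.
  have XE : (h^T *m P0)^T *m J' *m (h^T *m P0) = B.
    by rewrite trmx_mul trmxK BE -hE !mulmxA.
  have fX : row_free (h^T *m P0).
    by rewrite /row_free mxrankMfree // mxrank_unit // unitmx_tr.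
  rewrite XE eqxx fX; split=> //; apply/asboolP => i; rewrite -rot // XE rk //.
- move=> eta /asboolP [alt rk].
  have [s [rs]] := card_isometry altJ uJ alt.
  have -> : s = rho 2%N.
    by apply: double_inj; rewrite -rs -(rk 1%N) expr1 mxrank_unitl.
  move=> /(_ r2).
  rewrite (_ : m + m - (rho 2).*2 = (m - rho 2).*2)%N; last by rewrite addnn doubleB.
  move=> <-.
  apply: eq_card => X; rewrite !inE; case: eqP => [XE|]; rewrite ?andbF // !andbT.
  by case: (row_free X) => //=; rewrite XE; apply/asboolP.
Qed.

End Recursions.

(** Induction on a bound for the indices of the nonzero ranks.  Convexity of the
    rank sequence, which holds for profiles of partitions, is the condition under
    which the isometric embeddings of the recursion exist. *)
Theorem exotic_count_eq (F F2 : finFieldType) : #|F2| = (#|F| ^ 2)%N ->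
  forall L n (J : 'M[F]_(n + n)) (rho : nat -> nat),
  alternating J -> J \in unitmx -> rho 0%N = n ->
  (forall i, (L <= i)%N -> rho i = 0%N) ->
  (forall i, (rho i.+1 <= rho i)%N) ->
  (forall i, (rho i.+1 + rho i.+1 <= rho i + rho i.+2)%N) ->
  exotic_count J rho = nilpotent_count F2 n rho.
Proof.
move=> cF; have q1 := card_finNzRing_gt1 F; elim=> [|L IH] n J rho altJ uJ r0 rL mon conv.
  have n0 : n = 0%N by rewrite -r0 rL.
  move: J altJ uJ; rewrite n0 => J altJ uJ.
  rewrite /exotic_count /nilpotent_count !card_all0 //=; apply/asboolP.
    by move=> i; rewrite rL //; apply/eqP; rewrite -leqn0 rank_leq_row.
  split; first by split=> [|[]//]; apply: mx_no_rows_eq.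
  by move=> i; rewrite rL //; apply/eqP; rewrite -leqn0 rank_leq_row.
pose m := rho 1%N; have mn : (m <= n)%N by rewrite -r0 mon.
have sm : (rho 2 <= m)%N by exact: mon.
have cn : (m + m <= n + rho 2)%N by rewrite -r0 conv.
pose J' : 'M[F]_(m + m) := symp_mx F m.
have E := exotic_count_rec altJ uJ (alternating_symp_mx F m) (symp_mx_unit F m) r0 erefl cn.
have N := @nilpotent_count_rec F2 n m rho r0 erefl.
have I := isometry_lift_number #|F| sm mn.
rewrite (IH m J' (fun i => rho i.+1) (alternating_symp_mx F m) (symp_mx_unit F m) erefl
  (fun i Li => rL i.+1 Li) (fun i => mon i.+1) (fun i => conv i.+1)) in E.
rewrite cF in N.
have g1 := isometry_number_gt0 m q1.
have g2 : (0 < lift_number (#|F| ^ 2) m m 0)%N by apply: lift_number_gt0; rewrite -(expn0 #|F|) ltn_exp2l.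
apply/eqP; rewrite -(eqn_pmul2r g1) -(eqn_pmul2r g2) E -mulnA I; last by lia.
by rewrite mulnCA -N mulnCA mulnA.
Qed.

(** * Counting the vectors *)
Section SupportCount.
Variable S : nat -> nat -> Prop.

(** The condition of [reaches_cyclic_sum] for all [b] and [i], on coordinates
    indexed by [t] in position [s t] of a Jordan block of size [l t]. *)
Definition support_heights (R : nmodType) (T : finType) (s l : T -> nat) (c : T -> R) :=
  forall b i, (forall t, c t != 0 -> (i <= s t + b)%N || (l t <= s t + b)%N) <-> S b i.

(** The condition only depends on the support, so any bijection between [F2] and
    [F * F] that maps zero to zero transports it. *)
Lemma card_support_heights (F F2 : finZmodType) (T T' : finType) (s l : T -> nat) (h : T' -> T * bool) :
  #|F2| = (#|F| ^ 2)%N -> bijective h ->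
  #|[pred c : {ffun T' -> F} |
     `[< support_heights (fun t => s (h t).1) (fun t => l (h t).1) c >]]| =
  #|[pred c : {ffun T -> F2} | `[< support_heights s l c >]]|.
Proof.
move=> cF [h' hK h'K].
have e : #|F2| = #|{: F * F}| by rewrite card_prod cF -mulnn.
pose f0 (z : F2) : F * F := enum_val (cast_ord e (enum_rank z)).
have f0K : cancel f0 (fun p => enum_val (cast_ord (esym e) (enum_rank p))).
  by move=> z; rewrite /f0 enum_valK cast_ordK enum_rankK.
have f0K' : cancel (fun p => enum_val (cast_ord (esym e) (enum_rank p))) f0.
  by move=> z; rewrite /f0 enum_valK cast_ordKV enum_rankK.
(* The arbitrary bijection f0 is translated so that zero goes to zero. *)
pose f z := f0 z - f0 0; pose f' p := enum_val (cast_ord (esym e) (enum_rank (p + f0 0))).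
have fK : cancel f f' by move=> z; rewrite /f /f' subrK; exact: f0K.
have fK' : cancel f' f by move=> z; rewrite /f /f' f0K' addrK.
have f0E : f 0 = 0 by rewrite /f subrr.
pose sel (p : F * F) (b : bool) := if b then p.1 else p.2.
pose G (c : {ffun T -> F2}) : {ffun T' -> F} := [ffun t' => sel (f (c (h t').1)) (h t').2].
pose G' (d : {ffun T' -> F}) : {ffun T -> F2} := [ffun t => f' (d (h' (t, true)), d (h' (t, false)))].
have GK : cancel G G'.
  move=> c; apply/ffunP => t; rewrite !ffunE !h'K -[RHS]fK.
  by rewrite [in RHS](surjective_pairing (f (c t))).
have G'K : cancel G' G.
  move=> d; apply/ffunP => t'; rewrite !ffunE fK'.
  by rewrite -[in RHS](hK t'); case: (h t') => t [].
rewrite -(card_imset [pred c : {ffun T -> F2} | `[< support_heights s l c >]] (can_inj GK)).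
have suppE c (Q : T -> bool) : (forall t', G c t' != 0 -> Q (h t').1) <-> (forall t, c t != 0 -> Q t).
  split=> H t.
    rewrite -{1}[c t]fK; have [z|z] := eqVneq (f (c t)) 0.
      by rewrite z -f0E fK eqxx.
    move=> _; have : ((f (c t)).1 != 0) || ((f (c t)).2 != 0).
      by rewrite -negb_and; apply: contra z; case: (f (c t)) => a b /= /andP [/eqP -> /eqP ->].
    case/orP => nz.
      by have := H (h' (t, true)); rewrite ffunE h'K; apply.
    by have := H (h' (t, false)); rewrite ffunE h'K; apply.
  rewrite ffunE => nz; apply: H; apply: contraNneq nz => ->.
  by rewrite f0E; case: (h t).2.
have condE c : support_heights (fun t => s (h t).1) (fun t => l (h t).1) (G c) <->
    support_heights s l c.
  split=> H b i; have := H b i;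
    have /= := suppE c (fun t => (i <= s t + b)%N || (l t <= s t + b)%N);
    by move=> [h1 h2] [h3 h4]; split; tauto.
apply: eq_card => d; rewrite inE; apply/asboolP/imsetP => [Hd|[c]].
  have H : support_heights s l (G' d) by apply: (condE _).1; rewrite G'K.
  by exists (G' d); rewrite ?G'K //; exact: asboolT.
by move=> /asboolW Hc ->; apply: (condE _).2.
Qed.

Lemma card_reaches (F : finFieldType) n (x : 'M[F]_n) (u : 'I_n -> 'cV_n) lam :
  nilpotent_mx x -> jordan_generators x u lam -> (\sum_i lam i = n)%N ->
  #|[pred v : 'cV[F]_n | `[< forall b i, reaches x v b i <-> S b i >]]| =
  #|[pred c : {ffun {j : 'I_n & 'I_(lam j)} -> F} | `[< support_heights
     (fun t => nat_of_ord (tagged t)) (fun t => lam (tag t)) c >]]|.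
Proof.
move=> nx ju sz; pose T := {j : 'I_n & 'I_(lam j)}.
have sp v : exists C, v = cyclic_sum x u lam C by case: ju => gu au; apply: cyclic_expand.
pose ext (c : {ffun T -> F}) (j : 'I_n) (s : nat) : F :=
  if insub s is Some s' then c (@Tagged _ j (fun j => 'I_(lam j)) s') else 0.
have extE c (t : T) : ext c (tag t) (tagged t) = c t by rewrite /ext valK; case: t.
pose f c := cyclic_sum x u lam (ext c).
have f_inj : injective f.
  move=> c d /(cyclic_sum_inj nx ju sz) e; apply/ffunP => t.
  by rewrite -!extE e.
rewrite -(card_imset [pred c | _] f_inj); apply: eq_card => v; rewrite inE.
have condE c : (forall b i, reaches x (f c) b i <-> S b i) <->
   support_heights (fun t : T => nat_of_ord (tagged t)) (fun t : T => lam (tag t)) c.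
  have H b i : (forall t : T, c t != 0 -> (i <= tagged t + b)%N || (lam (tag t) <= tagged t + b)%N)
      <-> reaches x (f c) b i.
    rewrite (reaches_cyclic_sum nx ju sz); split=> H.
      move=> j s lt nz; have := H (@Tagged _ j (fun j => 'I_(lam j)) (Ordinal lt)).
      by rewrite -extE => /(_ nz).
    by move=> t nz; apply: H; rewrite ?extE.
  split=> K b i; first by rewrite H.
  by rewrite -H.
apply/asboolP/imsetP => [Hv|[c]]; last by move=> /asboolW Hc ->; apply: (condE _).2.
have [C vE] := sp v; pose c : {ffun T -> F} := [ffun t : T => C (tag t) (tagged t)].
have fc : v = f c.
  rewrite vE; apply: eq_bigr => j _; apply: eq_bigr => s _; congr (_ *: _).
  by rewrite -[RHS]/(ext c (tag (@Tagged _ j (fun j => 'I_(lam j)) s))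
    (tagged (@Tagged _ j (fun j => 'I_(lam j)) s))) extE ffunE.
by exists c => //; apply: asboolT; apply: (condE _).1; rewrite -fc.
Qed.

End SupportCount.

(** Sorted in nonincreasing order, the blocks of a doubled partition are indexed
    by [j], the size being that of the block [j./2] of the original one. *)
Lemma doubled_index n (lam : nat -> nat) :
  (\sum_(j < n) lam j = n)%N -> (\sum_(j < n + n) lam j./2 = n + n)%N ->
  exists h : {j : 'I_(n + n) & 'I_(lam j./2)} -> {j : 'I_n & 'I_(lam j)} * bool,
  [/\ bijective h, forall t, tagged (h t).1 = tagged t :> nat &
      forall t, tag (h t).1 = (tag t)./2 :> nat].
Proof.
move=> sz sz2.
have hp (j : 'I_(n + n)) : (j./2 < n)%N by have := ltn_ord j; lia.
pose h (t : {j : 'I_(n + n) & 'I_(lam j./2)}) : {j : 'I_n & 'I_(lam j)} * bool :=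
  (@Tagged _ (Ordinal (hp (tag t))) (fun j : 'I_n => 'I_(lam j)) (tagged t), odd (tag t)).
exists h; split=> //; apply: inj_card_bij; last first.
  by rewrite card_prod card_bool !card_cyclic_index sz sz2; lia.
move=> t t' E.
have /= e1 := congr1 (fun p : {j : 'I_n & 'I_(lam j)} * bool => nat_of_ord (tag p.1)) E.
have /= e2 := congr1 (fun p : {j : 'I_n & 'I_(lam j)} * bool => nat_of_ord (tagged p.1)) E.
have /= e3 := congr1 snd E.
case: t t' {E} e1 e2 e3 => [j s] [j' s'] /= ej es eo.
have e : j = j'.
  by apply: val_inj; rewrite /= -[val j]odd_double_half -[val j']odd_double_half /= ej eo.
by subst j'; congr existT; apply: val_inj.
Qed.

Theorem vector_count_eq (F F2 : finFieldType) n mu nu (x : 'M[F2]_n) (y : 'M[F]_(n + n)) :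
  #|F2| = (#|F| ^ 2)%N -> is_bipartition_of n mu nu ->
  (forall i, \rank (x ^+ i) = profile (partition_add mu nu) i) ->
  (forall i, \rank (y ^+ i) = (profile (partition_add mu nu) i).*2) ->
  #|[pred w : 'cV[F]_(n + n) | `[< forall b i, reaches y w b i <-> heights mu nu b i >]]| =
  #|[pred v : 'cV[F2]_n | `[< forall b i, reaches x v b i <-> heights mu nu b i >]]|.
Proof.
move=> cF bip rx ry; set la := partition_add mu nu in rx ry.
have nx : nilpotent_mx x.
  by exists n; apply/eqP; rewrite -mxrank_eq0 rx (profile0 bip).
have ny : nilpotent_mx y.
  by exists n; apply/eqP; rewrite -mxrank_eq0 ry (profile0 bip).
have [u [lam [_ [[ju sz] _ _ lni _]]]] := sorted_normal_form 0 nx.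
have [u' [lam' [_ [[ju' sz'] _ _ lni' _]]]] := sorted_normal_form 0 ny.
have lamE : lam = (fun j : 'I_n => nth 0%N la j).
  apply: funext; apply: profile_inj => // [i j|t]; first exact: (bipartition_sum_le bip).
  by rewrite -(rank_jordan nx ju sz) rx (profile_widen bip).
have dbl (g : nat -> nat) : (\sum_(j < n + n) g j./2 = (\sum_(j < n) g j).*2)%N.
  elim: (n) => [|k IH]; first by rewrite !big_ord0.
  rewrite addSn addnS !big_ord_recr /= IH doubleD -addnA; congr (_ + _)%N.
  by rewrite addnn doubleK uphalf_double addnn.
have lamE' : lam' = (fun j : 'I_(n + n) => nth 0%N la j./2).
  apply: funext; apply: profile_inj => // [i j ij|t].
    by apply: (bipartition_sum_le bip); exact: half_leq.
  rewrite -(rank_jordan ny ju' sz') ry (profile_widen bip).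
  by rewrite (dbl (fun j => nth 0%N la j - t)%N).
subst lam lam'.
have [h [hb h1 h2]] := doubled_index sz sz'.
rewrite (card_reaches _ ny ju' sz') (card_reaches _ nx ju sz).
rewrite -(card_support_heights _ _ _ cF hb); apply: eq_card => c; rewrite !inE.
apply: asbool_equiv_eq; split=> H b i; rewrite -(H b i); split=> K t nz; have := K t nz;
  by rewrite h1 h2.
Qed.

(** * Rational points *)
Section FiniteSubfield.
Variables (K : fieldType) (S : divringClosed K) (s : seq K).

(** The enumeration [hs] is a parameter of the type, so that the finite type
    structure can be inferred from it. *)
Definition finite_subfield (hs : s =i S) := {x : K | x \in S}.

Variable hs : s =i S.
Local Notation T := (finite_subfield hs).

HB.instance Definition _ := SubChoice.copy T {x : K | x \in S}.
HB.instance Definition _ := [SubChoice_isSubIntegralDomain of T by <:].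
HB.instance Definition _ := [SubIntegralDomain_isSubField of T by <:].

Definition subfield_index (x : T) : nat := index (val x) s.
Definition subfield_nth (i : nat) : option T := insub (nth 0 s i).

Lemma subfield_indexK : pcancel subfield_index subfield_nth.
Proof.
move=> x; rewrite /subfield_nth /subfield_index nth_index ?valK //.
by rewrite hs (valP x).
Qed.
HB.instance Definition _ := PCanIsCountable subfield_indexK.

Definition subfield_enum : seq T := undup (pmap insub s).
Lemma subfield_enumP : Finite.axiom subfield_enum.
Proof.
move=> x; rewrite count_uniq_mem ?undup_uniq // mem_undup mem_pmap_sub.
by rewrite hs (valP x).
Qed.
HB.instance Definition _ := isFinite.Build T subfield_enumP.


Lemma card_finite_subfield : uniq s -> #|{: T}| = size s.
Proof.
move=> us; suff /perm_size : perm_eq (map val (enum {: T})) s by rewrite size_map -cardE.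
apply: uniq_perm => //.
  by rewrite map_inj_uniq ?enum_uniq //; exact: val_inj.
move=> x; apply/mapP/idP => [[y _ ->]|xs]; first by rewrite hs (valP y).
have xS : x \in S by rewrite -hs.
by exists (Sub x xS : T); rewrite ?mem_enum ?SubK.
Qed.

End FiniteSubfield.

Lemma finite_subfield_model (K : fieldType) (S : divringClosed K) q :
  ([set` S] #= `I_q)%classic%card ->
  exists (F : finFieldType) (f : {rmorphism F -> K}), #|F| = q /\
    forall z, z \in S <-> exists a, f a = z.
Proof.
move=> hS; have fin : finite_set [set` S]%classic by exists q.
pose s : seq K := enum_fset (fset_set [set` S]%classic).
have hs : s =i S by move=> x; rewrite /s in_fset_set // mem_setE.
have us : uniq s by apply: fset_uniq.
exists (finite_subfield hs), (val : {rmorphism finite_subfield hs -> K}); split.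
  by rewrite card_finite_subfield // (card_fset_set hS).
move=> z; split=> [zS|[a <-]]; last exact: valP.
by exists (Sub z zS : finite_subfield hs); exact: SubK.
Qed.

Lemma card_eq_image_pred (T : finType) (U : choiceType) (f : T -> U) (P : pred T)
    (A : set U) : injective f -> (forall u, A u <-> exists2 t, P t & f t = u) ->
  (A #= `I_#|P|)%classic%card.
Proof.
move=> finj AE; pose s := map f (enum P).
have -> : A = [set` seq_fset tt s]%classic.
  have mem u : [set` seq_fset tt s]%classic u <-> u \in s by rewrite -(seq_fsetE tt).
  apply/seteqP; split=> u; first by move=> /AE [t Pt <-]; apply/mem; apply: map_f; rewrite mem_enum.
  by move=> /mem /mapP [t]; rewrite mem_enum => Pt ->; apply/AE; exists t.
apply/card_eq_fsetP; rewrite size_seq_fset undup_id ?size_map -?cardE //.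
by rewrite map_inj_uniq // enum_uniq.
Qed.

Definition has_heights (F : fieldType) N (mu nu : seq nat) (x : 'M[F]_N) (v : 'cV_N) : bool :=
  `[< forall b i, reaches x v b i <-> heights mu nu b i >].

Definition enhanced_model (F : finFieldType) n (mu nu : seq nat) :=
  [pred p : 'cV[F]_n * 'M[F]_n |
    `[< forall i, \rank (p.2 ^+ i) = profile (partition_add mu nu) i >] &&
    has_heights mu nu p.2 p.1].

Definition exotic_model (F : finFieldType) n (mu nu : seq nat) :=
  [pred p : 'cV[F]_(n + n) * 'M[F]_(n + n) |
    `[< alternating (symp_mx F n *m p.2) /\
        forall i, \rank (p.2 ^+ i) = (profile (partition_add mu nu) i).*2 >] &&
    has_heights mu nu p.2 p.1].

Section RationalPoints.
Variables (K : fieldType) (S : divringClosed K) (F : finFieldType) (f : {rmorphism F -> K}).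
Hypothesis fS : forall z, z \in S <-> exists a, f a = z.

Lemma mxOver_map m n (A : 'M[K]_(m, n)) :
  A \is a mxOver S <-> exists B : 'M[F]_(m, n), map_mx f B = A.
Proof.
split=> [/mxOverP AS|[B <-]]; last first.
  by apply/mxOverP => i j; rewrite mxE; apply/fS; exists (B i j).
have /choice [g gE] (ij : 'I_m * 'I_n) : exists a, f a = A ij.1 ij.2 by apply/fS/AS.
by exists (\matrix_(i, j) g (i, j)); apply/matrixP => i j; rewrite !mxE gE.
Qed.

Definition map_point m (p : 'cV[F]_m * 'M[F]_m) : 'cV[K]_m * 'M[K]_m :=
  (map_mx f p.1, map_mx f p.2).

Lemma map_point_inj m : injective (@map_point m).
Proof. by move=> [v x] [w y] [/map_mx_inj -> /map_mx_inj ->]. Qed.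

Lemma rational_pointsP m (X : set ('cV[K]_m * 'M[K]_m)) (P : pred ('cV[F]_m * 'M[F]_m)) :
  (forall p, X (map_point p) <-> P p) -> 
  (rational_points S X #= `I_#|P|)%classic%card.
Proof.
move=> XP; apply: (card_eq_image_pred (@map_point_inj m)) => -[v x]; split.
  move=> [/= Xp /mxOver_map [v' vE] /mxOver_map [x' xE]]; exists (v', x').
    by apply/XP; rewrite /map_point /= vE xE.
  by rewrite /map_point /= vE xE.
move=> [[v' x'] Pp [<- <-]]; split=> /=; last 2 first.
- by apply/mxOver_map; exists v'.
- by apply/mxOver_map; exists x'.
exact: (XP (v', x')).2.
Qed.

Lemma map_mx_exp n (x : 'M[F]_n) i : map_mx f (x ^+ i) = map_mx f x ^+ i.
Proof.
elim: i => [|i IH]; first by rewrite !expr0 map_mx1.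
by rewrite !exprS -!mulmxE map_mxM IH.
Qed.

Lemma rank_map_exp n (x : 'M[F]_n) i : \rank (map_mx f x ^+ i) = \rank (x ^+ i).
Proof. by rewrite -map_mx_exp mxrank_map. Qed.

Lemma reaches_map n (x : 'M[F]_n) v b i :
  reaches (map_mx f x) (map_mx f v) b i = reaches x v b i.
Proof. by rewrite /reaches -!map_mx_exp -map_mxM !map_trmx map_submx. Qed.

Lemma alternating_map n (B : 'M[F]_n) : alternating (map_mx f B) <-> alternating B.
Proof.
split=> -[sk dg]; split=> [|i].
- by apply: (map_mx_inj (f := f)); rewrite map_mxN -map_trmx.
- by apply: (fmorph_inj f); have := dg i; rewrite mxE rmorph0.
- by rewrite map_trmx sk map_mxN.
- by rewrite mxE dg rmorph0.
Qed.

Lemma map_symp_mx n : map_mx f (symp_mx F n) = symp_mx K n.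
Proof. by rewrite map_block_mx !map_mx0 map_mxN map_mx1. Qed.

Variables (n : nat) (mu nu : seq nat).
Hypothesis bip : is_bipartition_of n mu nu.
Local Notation la := (partition_add mu nu).

Lemma nilpotent_profile (L : fieldType) N (x : 'M[L]_N) c :
  (forall i, \rank (x ^+ i) = (profile la i * c)%N) -> nilpotent_mx x.
Proof. by move=> rx; exists n; apply/eqP; rewrite -mxrank_eq0 rx (profile0 bip). Qed.

Lemma rational_enhanced_orbit :
  (rational_points S (enhanced_orbit K n mu nu) #=
   `I_#|enhanced_model F n mu nu|)%classic%card.
Proof.
apply: rational_pointsP => -[v x]; rewrite (enhanced_orbitP bip) /=.
split=> [[_ rk ht]|/andP [/asboolP rk /asboolP ht]].
  apply/andP; split; apply/asboolP; first by move=> i; rewrite -rank_map_exp.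
  by move=> b i; rewrite -reaches_map.
split=> [|i|b i]; last 2 first.
- by rewrite rank_map_exp.
- by rewrite reaches_map.
by apply: (@nilpotent_profile _ _ _ 1%N) => i; rewrite rank_map_exp rk muln1.
Qed.

Lemma rational_exotic_orbit :
  (rational_points S (exotic_orbit K n mu nu) #=
   `I_#|exotic_model F n mu nu|)%classic%card.
Proof.
apply: rational_pointsP => -[w y]; rewrite (exotic_orbitP bip) /=.
have altE : alternating (symp_mx K n *m map_mx f y) <-> alternating (symp_mx F n *m y).
  by rewrite -map_symp_mx -map_mxM alternating_map.
split=> [[/exotic_coneP [_ /altE alt] rk ht]|/andP [/asboolP [/altE alt rk] /asboolP ht]].
  apply/andP; split; apply/asboolP; last by move=> b i; rewrite -reaches_map.
  by split=> // i; rewrite -rank_map_exp.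
split=> [|i|b i]; last 2 first.
- by rewrite rank_map_exp.
- by rewrite reaches_map.
by apply/exotic_coneP; split=> //; apply: (@nilpotent_profile _ _ _ 2%N) => i; rewrite rank_map_exp rk muln2.
Qed.

End RationalPoints.

Lemma card_pair_pred (A B : finType) (P : pred B) (Q : A -> B -> bool) c :
  (forall b, P b -> #|[pred a | Q a b]| = c) ->
  #|[pred p : A * B | P p.2 && Q p.1 p.2]| = (#|P| * c)%N.
Proof.
move=> Qc; apply: (@card_fibers _ _ _ snd) => [[a b] /andP [] //|b Pb].
rewrite -(Qc b Pb) -(card_imset [pred a | Q a b] (f := fun a => (a, b))); last by move=> a a' [].
apply: eq_card => -[a b']; rewrite !inE /=; apply/andP/imsetP.
  by move=> [/andP [_ Qa] /eqP e]; rewrite e in Qa *; exists a.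
by move=> [a']; rewrite inE => Qa [-> ->]; rewrite Pb Qa.
Qed.

Lemma profile_convex mu nu i :
  (profile (partition_add mu nu) i.+1 + profile (partition_add mu nu) i.+1 <=
   profile (partition_add mu nu) i + profile (partition_add mu nu) i.+2)%N.
Proof.
by rewrite -!big_split; apply: leq_sum => j _ /=; lia.
Qed.

(** The number of vectors does not depend on the endomorphism, so each side is
    the number of endomorphisms times a common number of vectors. *)
Theorem card_orbits (F F2 : finFieldType) n mu nu : #|F2| = (#|F| ^ 2)%N ->
  is_bipartition_of n mu nu ->
  #|exotic_model F n mu nu| =
  #|enhanced_model F2 n mu nu|.
Proof.
move=> cF bip; pose la := partition_add mu nu.
pose PE := [pred y : 'M[F]_(n + n) |
  `[< alternating (symp_mx F n *m y) /\ forall i, \rank (y ^+ i) = (profile la i).*2 >]].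
pose PN := [pred x : 'M[F2]_n | `[< forall i, \rank (x ^+ i) = profile la i >]].
have uM := symp_mx_unit F n; pose J := invmx (symp_mx F n).
(* Congruence by J turns the alternating matrix into the transpose of J. *)
have altJ : alternating J.
  have := alternating_congr J (alternating_symp_mx F n).
  rewrite mulVmx // mul1mx => -[]; rewrite trmxK => sk dg.
  split=> [|i]; first by rewrite [in RHS]sk opprK.
  by have := dg i; rewrite mxE.
have uJ : J \in unitmx by rewrite unitmx_inv.
have EN : #|PE| = #|PN|.
  have <- : exotic_count J (profile la) = #|PE|.
    rewrite /exotic_count -(card_imset [pred B | _] (can_inj (mulKmx uJ))).
    apply: eq_card => y; rewrite inE; apply/imsetP/asboolP => [[B /asboolW [alt rk] ->]|[alt rk]].
      by rewrite mulKVmx.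
    exists (symp_mx F n *m y); last by rewrite mulKmx.
    by apply: asboolT; rewrite mulKmx.
  apply: (exotic_count_eq cF (L := n)) => //.
  - by rewrite /profile; under eq_bigr do rewrite subn0; exact: (bipartition_sum bip).
  - by move=> i; exact: (profile0 bip).
  - by move=> i; apply: leq_sum => j _; lia.
  - exact: profile_convex.
pose cE (y : 'M[F]_(n + n)) := #|[pred w | has_heights mu nu y w]|.
pose cN (x : 'M[F2]_n) := #|[pred v | has_heights mu nu x v]|.
have cEN x y : PN x -> PE y -> cE y = cN x.
  by move=> /asboolP rx /asboolP [_ ry]; exact: vector_count_eq.
have [c [hE hN]] : exists c, (forall y, PE y -> cE y = c) /\ (forall x, PN x -> cN x = c).
  have [x0 Px0|noN] := pickP PN; have [y0 Py0|noE] := pickP PE.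
  - exists (cN x0); split=> [y Py|x Px]; first exact: cEN.
    by rewrite -(cEN x y0) // (cEN x0 y0).
  - move: EN; rewrite (eq_card0 noE) => /esym/card0_eq/(_ x0).
    by rewrite -[x0 \in PN]/(PN x0) Px0.
  - move: EN; rewrite (eq_card0 noN) => /card0_eq/(_ y0).
    by rewrite -[y0 \in PE]/(PE y0) Py0.
  - by exists 0%N; split=> [y|x]; rewrite ?noE ?noN.
by rewrite (card_pair_pred (P := PE) hE) (card_pair_pred (P := PN) hN) EN.
Qed.

Local Open Scope classical_set_scope.
Local Open Scope card_scope.
Local Open Scope ring_scope.

Theorem corollary3p12 (k : closedFieldType) (q : nat) (Fq Fq2 : divringClosed k)
    (hFq : [set` Fq] #= `I_q) (hFq2 : [set` Fq2] #= `I_(q ^ 2))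
    (hsub : {subset Fq <= Fq2})
    (n : nat) (mu nu : seq nat) (hmunu : is_bipartition_of n mu nu) :
  rational_points Fq (exotic_orbit k n mu nu) #=
  rational_points Fq2 (enhanced_orbit k n mu nu).
Proof.
have [F [f [cF fS]]] := finite_subfield_model hFq.
have [F2 [f2 [cF2 fS2]]] := finite_subfield_model hFq2.
apply: card_eq_trans (rational_exotic_orbit fS hmunu) _.
have cFF : #|F2| = (#|F| ^ 2)%N by rewrite cF2 cF.
rewrite (card_orbits cFF hmunu) card_eq_sym.
exact (rational_enhanced_orbit fS2 hmunu).
Qed.
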